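(* Let $(G,\boldsymbol{\gamma})$ be a $\mathbb{Z}/2\mathbb{Z}$-colored graph with $n$ vertices and $2n-1$ edges, with symmetric lift $(\tilde G,\varphi)$. Then there exist directions $\vec d=(\vec d_{ij})_{ij\in E(G)}$ such that the reflection direction networks $(\tilde G,\varphi,\vec d)$ and $(\tilde G,\varphi,\vec d^{\perp})$ form a special pair if and only if $(G,\boldsymbol{\gamma})$ is reflection-Laman.
   Context: A colored graph $(G,\boldsymbol{\gamma})$ is a finite directed multigraph $G=(V,E)$ (self-loops and parallel edges allowed) with a color $\gamma_{ij}\in\mathbb{Z}/2\mathbb{Z}$ on each edge. $\rho:H_1(G,\mathbb{Z})\to\mathbb{Z}/2\mathbb{Z}$ sends a cycle to the sum of its edge colors; the $\rho$-image of a subgraph is the image of its cycles, trivial if $\{0\}$. For a subgraph $G'$: $n',m'$ are its numbers of vertices and edges, $c'$ (resp. $c'_0$) the number of its connected components with non-trivial (resp. trivial) $\rho$-image. $(G,\boldsymbol{\gamma})$ is reflection-Laman if $m=2n-1$ and every subgraph satisfies $m'\le 2n'-c'-3c'_0$. The lift $(\tilde G,\varphi)$ has vertices $\tilde i_\gamma$ ($i\in V,\gamma\in\mathbb{Z}/2\mathbb{Z}$), edges $\tilde i_\gamma\tilde j_{\gamma+\gamma_{ij}}$ for each edge $ij$, and $\varphi(\tilde i_\gamma)=\tilde i_{\gamma+1}$. Let $\Phi$ be the action of $\mathbb{Z}/2\mathbb{Z}$ on $\mathbb{R}^2$ with $\Phi(1)$ the reflection $(x,y)\mapsto(-x,y)$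 through the $y$-axis. A reflection direction network $(\tilde G,\varphi,\vec d)$ is given by a vector $\vec d_{ij}\in\mathbb{R}^2$ for each edge $ij$ of $G$; its realizations are the symmetric point sets $\vec p=(\vec p_v)_{v\in V(\tilde G)}$, $\vec p_{\tilde i_\gamma}=\Phi(\gamma)\vec p_i$ for points $\vec p_i\in\mathbb{R}^2$ ($i\in V$), satisfying $\langle \Phi(\gamma_{ij})\vec p_j-\vec p_i,\vec d_{ij}^{\perp}\rangle=0$ for all edges $ij\in E(G)$, where $\vec d^\perp$ is $\vec d$ rotated by $\pi/2$ (equivalently, each edge of $\tilde G$ is perpendicular to the perpendicular of its induced direction). $\vec d^\perp$ denotes the assignment $(\vec d_{ij}^\perp)$. A realization is faithful if no edge of $\tilde G$ has coincident endpoints, and collapsed if all vertices of $\tilde G$ are at the same point. The networks $(\tilde G,\varphi,\vec d)$ and $(\tilde G,\varphi,\vec d^\perp)$ form a special pair if $(\tilde G,\varphi,\vec d)$ has a faithful realization and $(\tilde G,\varphi,\vec d^\perp)$ has only collapsed realizations. *)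

(* Defs.v *)
From HB Require Import structures.
From mathcomp Require Import all_boot all_order all_algebra.
From mathcomp Require Import boolp reals.

Set Implicit Arguments.
Unset Strict Implicit.
Unset Printing Implicit Defensive.

Import Order.TTheory GRing.Theory Num.Theory.

(* A Z/2Z-colored directed multigraph with vertex set 'I_n and edge set 'I_m.
   Edge e goes from [src e] to [tgt e] (self-loops and parallel edges allowed)
   and carries the color [col e] in Z/2Z, represented by bool (addition = addb). *)
Record cgraph (n m : nat) := CGraph {
  src : 'I_m -> 'I_n;
  tgt : 'I_m -> 'I_n;
  col : 'I_m -> bool }.

Section Combinatorics.
Variables (n m : nat) (G : cgraph n m).

Definition walk_step (u : 'I_n) (s : 'I_m * bool) : option 'I_n :=
  if s.2 then (if src G s.1 == u then Some (tgt G s.1) else None)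
  else (if tgt G s.1 == u then Some (src G s.1) else None).

Fixpoint walk_end (u : 'I_n) (w : seq ('I_m * bool)) : option 'I_n :=
  match w with
  | [::] => Some u
  | s :: w' => match walk_step u s with
               | Some v => walk_end v w'
               | None => None
               end
  end.

(* rho of a walk: sum in Z/2Z of the colors of its edges (orientation is
   irrelevant in Z/2Z since -gamma = gamma) *)
Definition walk_rho (w : seq ('I_m * bool)) : bool :=
  foldr addb false [seq col G s.1 | s <- w].

Definition sub_vertices (F : {set 'I_m}) : {set 'I_n} :=
  [set v | [exists e in F, (src G e == v) || (tgt G e == v)]].

Definition sub_adj (F : {set 'I_m}) : rel 'I_n :=
  fun u v => [exists e in F, ((src G e == u) && (tgt G e == v))
                          || ((src G e == v) && (tgt G e == u))].

Definition components (F : {set 'I_m}) : {set {set 'I_n}} :=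
  [set [set u | connect (sub_adj F) v u] | v in sub_vertices F].

Definition rho_nontrivial (F : {set 'I_m}) (C : {set 'I_n}) : Prop :=
  exists (v : 'I_n) (w : seq ('I_m * bool)),
    [/\ v \in C, all (fun s => s.1 \in F) w, walk_end v w = Some v
      & walk_rho w = true].

Definition c_nontriv (F : {set 'I_m}) : nat :=
  #|[set C in components F | `[< rho_nontrivial F C >] ]|.

Definition c_triv (F : {set 'I_m}) : nat :=
  #|[set C in components F | ~~ `[< rho_nontrivial F C >] ]|.

Definition reflection_Laman : Prop :=
  (m%:Z = 2 * n%:Z - 1)%R /\
  forall F : {set 'I_m},
    (#|F|%:Z <= 2 * #|sub_vertices F|%:Z - (c_nontriv F)%:Z
                 - 3 * (c_triv F)%:Z)%R.

End Combinatorics.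

Section Geometry.
Local Open Scope ring_scope.
Variable R : realType.

Definition Phi (g : bool) (p : R * R) : R * R := if g then (- p.1, p.2) else p.

Definition perp (d : R * R) : R * R := (- d.2, d.1).

Definition dot (p q : R * R) : R := p.1 * q.1 + p.2 * q.2.

Definition psub (p q : R * R) : R * R := (p.1 - q.1, p.2 - q.2).

Variables (n m : nat) (G : cgraph n m).

Definition is_realization (d : 'I_m -> R * R) (p : 'I_n -> R * R) : Prop :=
  forall e : 'I_m, dot (psub (Phi (col G e) (p (tgt G e))) (p (src G e)))
                       (perp (d e)) = 0.

(* position of the lifted vertex (i, g) = i~_g : Phi(g) p_i *)
Definition lift_pos (p : 'I_n -> R * R) (v : 'I_n * bool) : R * R :=
  Phi v.2 (p v.1).

(* faithful: no edge i~_g j~_(g + gamma_ij) of the lift has coincident ends *)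
Definition faithful (p : 'I_n -> R * R) : Prop :=
  forall (e : 'I_m) (g : bool),
    lift_pos p (src G e, g) <> lift_pos p (tgt G e, addb g (col G e)).

Definition collapsed (p : 'I_n -> R * R) : Prop :=
  forall u v : 'I_n * bool, lift_pos p u = lift_pos p v.

Definition special_pair (d : 'I_m -> R * R) : Prop :=
  (exists p, is_realization d p /\ faithful p) /\
  (forall p, is_realization (fun e => perp (d e)) p -> collapsed p).

End Geometry.

(* Main.v *)
Require Import Defs.
From HB Require Import structures.
From mathcomp Require Import all_boot all_order all_algebra.
From mathcomp Require Import boolp reals.
From mathcomp Require Import ring lra zify.

(* If p is a faithful realization of d, then d_e is a multiple of the edge vector
   Phi(c) p_j - p_i, so the system of the network d^perp is the symmetric rigidity
   system at p, and it has only collapsed solutions iff its 2n-1 rows are independent.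
   Hence a special pair exists iff some p makes all the rigidity rows independent
   (such a p is faithful, since a collapsed edge has a zero row).

   Independence forces the Laman counts: a connected subgraph admits the translation
   along the mirror, and, if its rho-image is trivial, it lifts to two disjoint copies
   and admits all the rigid motions of one copy.

   Conversely, independent rows are constructed by induction on the number of vertices,
   removing a vertex v of degree at most 3.  The delicate case is that of three neighbours
   with lifts a, b, c: one must be able to put back an edge ab, bc or ca without violating
   the counts.  Otherwise each of the three pairs lies in a tight, hence infinitesimally
   rigid, set; the three rigid motions agree pairwise at the vertices of the nondegenerate
   triangle abc, so they coincide, and the union of the tight sets is rigid, which leaves
   no room for the three edges at v. *)

Set Implicit Arguments.
Unset Strict Implicit.
Unset Printing Implicit Defensive.

Import Order.TTheory GRing.Theory Num.Theory.

Local Open Scope ring_scope.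

(** * Orthogonality in the space of motions *)

Section LinearAlgebra.
Variables (R : realFieldType) (n : nat).
Implicit Types (p q v w : 'M[R]_(n, 2)) (L K : seq 'M[R]_(n, 2)) (X : {set 'I_n}).

Definition dotm v w : R := \sum_i \sum_j v i j * w i j.

Lemma dotmC v w : dotm v w = dotm w v.
Proof. by apply: eq_bigr => i _; apply: eq_bigr => j _; rewrite mulrC. Qed.

Lemma dotm_linear v : linear (dotm v : 'M[R]_(n, 2) -> R^o).
Proof.
move=> a x y; rewrite /dotm scaler_sumr -big_split /=; apply: eq_bigr => i _.
rewrite scaler_sumr -big_split /=; apply: eq_bigr => j _.
by rewrite !mxE mulrDr /GRing.scale /= mulrCA.
Qed.

HB.instance Definition _ v :=
  GRing.isLinear.Build R 'M[R]_(n, 2) R^o _ (dotm v) (dotm_linear v).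

Lemma dotm_delta v i j : dotm v (delta_mx i j) = v i j.
Proof.
rewrite /dotm (bigD1 i) //= (bigD1 j) //= mxE !eqxx mulr1.
rewrite [X in _ + X + _]big1 ?[X in _ + _ + X]big1 ?addr0 // => k.
  by move=> ki; rewrite big1 // => l _; rewrite mxE (negbTE ki) mulr0.
by move=> kj; rewrite mxE (negbTE kj) andbF mulr0.
Qed.

Lemma dotm_eq0 v : dotm v v = 0 -> v = 0.
Proof.
move=> h; apply/matrixP => i j; rewrite mxE; apply/eqP; rewrite -sqrf_eq0 expr2.
have ge0 k : 0 <= \sum_l v k l * v k l by apply: sumr_ge0 => l _; rewrite -expr2 sqr_ge0.
have /eqP := h; rewrite psumr_eq0 => [/allP /(_ i)|k _]; last exact: ge0.
rewrite mem_index_enum => /(_ isT) /=; rewrite psumr_eq0 => [/allP /(_ j)|k _].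
  by rewrite mem_index_enum => /(_ isT).
by rewrite -expr2 sqr_ge0.
Qed.

Lemma span_orth L w : (forall l, l \in L -> dotm l w = 0) ->
  forall v, v \in <<L>>%VS -> dotm v w = 0.
Proof.
move=> h v vL.
have : (<<L>> <= lker (linfun (dotm w : 'M[R]_(n, 2) -> R^o)))%VS.
  by apply/span_subvP => l lL; rewrite memv_ker lfunE /= dotmC; apply/eqP/h.
by move=> /subvP /(_ _ vL); rewrite memv_ker lfunE /= dotmC => /eqP.
Qed.

Lemma span_coord L i j : (forall l, l \in L -> l i j = 0) ->
  forall v, v \in <<L>>%VS -> v i j = 0.
Proof.
move=> h v; rewrite -dotm_delta; apply: span_orth => l lL.
by rewrite dotm_delta h.
Qed.

(** Rank-nullity for the map sending [q] to its products with the members of [L]. *)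
Lemma exists_orth L : (size L < 2 * n)%N ->
  exists2 q, q != 0 & forall l, l \in L -> dotm l q = 0.
Proof.
move=> hL; pose g q := \row_(i < size L) dotm L`_i q.
have gl : linear g by move=> a x y; apply/rowP => i; rewrite !mxE linearP.
pose gL := GRing.isLinear.Build R 'M[R]_(n, 2) 'rV[R]_(size L) _ g gl.
pose gf : {linear _ -> _} := HB.pack g gL.
pose f := linfun gf.
have hd := limg_ker_dim f fullv.
have : lker f != 0%VS.
  apply/eqP => k0; move: hd; rewrite k0 capv0 dimv0 add0n dimvf /dim /= => e.
  have := dimvS (subvf (limg f)); rewrite e dimvf /dim /=; lia.
rewrite -vpick0 => q0; exists (vpick (lker f)) => // l lL.
have := memv_pick (lker f); rewrite memv_ker lfunE /= => /eqP /rowP.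
have il : (index l L < size L)%N by rewrite index_mem.
by move=> /(_ (Ordinal il)); rewrite !mxE /= nth_index.
Qed.

Definition supported X v := forall u, u \notin X -> forall j, v u j = 0.

Definition deltas X := [seq delta_mx u j : 'M[R]_(n, 2) | u <- enum X, j <- enum 'I_2].

Lemma size_deltas X : size (deltas X) = (2 * #|X|)%N.
Proof. by rewrite size_allpairs -!cardE card_ord mulnC. Qed.

Lemma mem_deltas X u j : u \in X -> delta_mx u j \in deltas X.
Proof. by move=> uX; apply: allpairs_f; rewrite mem_enum. Qed.

Lemma supported_span X v : supported X v -> v \in <<deltas X>>%VS.
Proof.
move=> h; rewrite (matrix_sum_delta v); apply: memv_suml => i _.
apply: memv_suml => j _; have [iX|/h ->] := boolP (i \in X).
  by apply/memvZ/memv_span/mem_deltas.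
by rewrite scale0r mem0v.
Qed.

(** Support in [X] is itself orthogonality to the coordinate vectors outside [X], so these are added
    to [L]. *)
Lemma exists_orth_supported X L : (size L < 2 * #|X|)%N ->
  exists q, [/\ q != 0, supported X q & forall l, l \in L -> dotm l q = 0].
Proof.
move=> hL; have := @exists_orth (L ++ deltas (~: X)).
rewrite size_cat size_deltas cardsCs setCK card_ord => -[].
  by have := max_card X; rewrite card_ord; lia.
move=> q q0 h; exists q; split=> // [u uX j|l lL].
  rewrite -dotm_delta dotmC; apply: h; rewrite mem_cat mem_deltas ?orbT //.
  by rewrite inE.
by apply: h; rewrite mem_cat lL.
Qed.

(** The two spans are orthogonal, hence meet only in 0 by positive definiteness, and both lie in a
    space of dimension 2|X|. *)
Lemma free_orth_size X L K : free L -> free K ->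
    (forall l, l \in L -> supported X l) -> (forall k, k \in K -> supported X k) ->
    (forall l k, l \in L -> k \in K -> dotm l k = 0) ->
  (size L + size K <= 2 * #|X|)%N.
Proof.
move=> /eqP fL /eqP fK sL sK h.
have hs : (<<L>> + <<K>> <= <<deltas X>>)%VS.
  by rewrite subv_add; apply/andP; split; apply/span_subvP => v vL;
     apply: supported_span; [apply: sL | apply: sK].
have dis : (<<L>> :&: <<K>> = 0)%VS.
  apply/eqP; rewrite -subv0; apply/subvP => v; rewrite memv_cap => /andP[vL vK].
  rewrite memv0; apply/eqP/dotm_eq0; apply: span_orth vL => l lL; rewrite dotmC.
  by apply: span_orth vK => k kK; rewrite dotmC h.
have := dimvS hs; rewrite dimv_disjoint_sum // fL fK => /leq_trans; apply.
by rewrite -size_deltas dim_span.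
Qed.

Lemma free_map_filter (T : eqType) (f : T -> 'M[R]_(n, 2)) (P : pred T) (s : seq T) :
  free (map f s) -> free (map f (filter P s)).
Proof.
have /(perm_map f) /perm_free <- : perm_eq (filter P s ++ filter (predC P) s) s.
  by rewrite perm_filterC.
by rewrite map_cat => /catl_free.
Qed.

End LinearAlgebra.

(** * Rigidity rows and rigid motions *)

Local Notation edge n := ('I_n * 'I_n * bool)%type.

Section SparseEdges.
Variable n : nat.
Implicit Types (X : {set 'I_n}) (s : 'I_n -> bool) (E : seq (edge n)).

Definition within X : pred (edge n) := fun e => (e.1.1 \in X) && (e.1.2 \in X).

(* The edges along which s is a potential for rho; s selects a copy in the lift. *)
Definition balanced s : pred (edge n) := fun e => e.2 == s e.1.1 (+) s e.1.2.

(* The Laman counts for vertex sets, without connected components. *)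
Definition sparse E :=
  (forall X, (0 < count (within X) E -> count (within X) E + 1 <= 2 * #|X|)%N) /\
  (forall s X, (0 < count (predI (within X) (balanced s)) E ->
     count (predI (within X) (balanced s)) E + 3 <= 2 * #|X|)%N).

End SparseEdges.

Section Rigidity.
Variables (R : realFieldType) (n : nat).
Implicit Types (p q v w : 'M[R]_(n, 2)) (L : seq 'M[R]_(n, 2)) (X : {set 'I_n}).
Implicit Types (e : edge n) (s : 'I_n -> bool).

Definition sg (b : bool) : R := if b then -1 else 1.

Definition xdiff p e := sg e.2 * p e.1.2 0 - p e.1.1 0.
Definition ydiff p e := p e.1.2 1 - p e.1.1 1.

(* Row of the network d^perp at e, for d_e = (dx, dy): its product with a motion q is
   <Phi(c) q_j - q_i, d_e>. *)
Definition dir_row e (dx dy : R) : 'M[R]_(n, 2) :=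
  dx *: (sg e.2 *: delta_mx e.1.2 0 - delta_mx e.1.1 0)
  + dy *: (delta_mx e.1.2 1 - delta_mx e.1.1 1).

(** The direction is the edge vector at [p] itself: this is the row of the symmetric rigidity
    matrix. *)
Definition rig_row p e := dir_row e (xdiff p e) (ydiff p e).

Lemma dotm_dir_row e dx dy q :
  dotm (dir_row e dx dy) q = dx * xdiff q e + dy * ydiff q e.
Proof.
rewrite dotmC /dir_row linearD /= !linearZ /= !linearB /= linearZ /= !dotm_delta.
by rewrite /GRing.scale /= /xdiff /ydiff; ring.
Qed.

Lemma dir_row_supported X e dx dy : within X e -> supported X (dir_row e dx dy).
Proof.
case/andP=> i1 i2 u uX j; rewrite !mxE.
have /negbTE -> : u != e.1.1 by apply: contraNneq uX => ->.
have /negbTE -> : u != e.1.2 by apply: contraNneq uX => ->.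
by rewrite /=; ring.
Qed.

Definition restr X q : 'M[R]_(n, 2) := \matrix_(u, k) if u \in X then q u k else 0.

Lemma restr_supported X q : supported X (restr X q).
Proof. by move=> u /negbTE uX j; rewrite mxE uX. Qed.

Lemma dotm_restr X v q : supported X v -> dotm v (restr X q) = dotm v q.
Proof.
move=> h; apply: eq_bigr => i _; apply: eq_bigr => j _; rewrite mxE.
by case: ifPn => // /h ->; rewrite !mul0r.
Qed.

(* The rigid motion z |-> (t1 - th z_y, t2 + th z_x), read on the lifts with
   sheet [s u] of the vertices u of X. *)
Definition motion p s X (t1 t2 th : R) : 'M[R]_(n, 2) :=
  restr X (\matrix_(u, k) if k == 0 then sg (s u) * (t1 - th * p u 1)
                          else t2 + th * (sg (s u) * p u 0)).

Lemma motionE0 p s X t1 t2 th u : u \in X ->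
  motion p s X t1 t2 th u 0 = sg (s u) * (t1 - th * p u 1).
Proof. by move=> uX; rewrite !mxE uX. Qed.

Lemma motionE1 p s X t1 t2 th u : u \in X ->
  motion p s X t1 t2 th u 1 = t2 + th * (sg (s u) * p u 0).
Proof. by move=> uX; rewrite !mxE uX. Qed.

Lemma motion_lin p s X a b c :
  a *: motion p s X 1 0 0 + (b *: motion p s X 0 1 0 + c *: motion p s X 0 0 1)
  = motion p s X a b c.
Proof.
by apply/matrixP => u k; rewrite !mxE; case: ifP => _; [case: ifP => _ |]; ring.
Qed.

(** A balanced edge joins, up to the reflection, the copies selected by [s]; its ends follow a
    common rigid motion, which preserves its length to first order. *)
Lemma rig_row_motion p s X t1 t2 th e : within X e -> balanced s e ->
  dotm (rig_row p e) (motion p s X t1 t2 th) = 0.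
Proof.
case: e => -[i j] c /andP[/= iX jX] /eqP /= ->.
rewrite dotm_dir_row /xdiff /ydiff /= !motionE0 // !motionE1 //.
by case: (s i); case: (s j); rewrite /sg /=; ring.
Qed.

(** Translation along the mirror commutes with the reflection, so it preserves edges of either
    color. *)
Lemma rig_row_translation p q s X t e : within X e ->
  dotm (rig_row p e) (motion q s X 0 t 0) = 0.
Proof.
case: e => -[i j] c /andP[/= iX jX].
rewrite dotm_dir_row /xdiff /ydiff /= !motionE0 // !motionE1 //; ring.
Qed.

Lemma motion_eq0 p s X t1 t2 th a b : a \in X -> b \in X ->
    (sg (s a) * p a 0, p a 1) != (sg (s b) * p b 0, p b 1) ->
  motion p s X t1 t2 th = 0 -> [/\ t1 = 0, t2 = 0 & th = 0].
Proof.
move=> aX bX ab /matrixP h.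
have := (h a 0, h a 1, h b 0, h b 1); rewrite !mxE aX bX /=.
have sg0 x (y : R) : sg x * y = 0 -> y = 0 by case: x; rewrite /sg; lra.
case=> [[[/sg0 a0 a1] /sg0 b0] b1].
have th0 : th = 0.
  (* If [th] were nonzero, both points would be the centre of the infinitesimal rotation. *)
  apply/eqP/negPn/negP => th0; case/negP: ab; apply/eqP; congr (_, _).
    by apply: (mulfI th0); lra.
  by apply: (mulfI th0); lra.
by move: a0 a1; rewrite th0; split=> //; lra.
Qed.

Lemma motions_free p s X a b : a \in X -> b \in X ->
    (sg (s a) * p a 0, p a 1) != (sg (s b) * p b 0, p b 1) ->
  free [:: motion p s X 1 0 0; motion p s X 0 1 0; motion p s X 0 0 1].
Proof.
move=> aX bX ab; apply/(freeP (X := [tuple _; _; _])) => k.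
rewrite !big_ord_recl big_ord0 /= addr0 motion_lin => /(motion_eq0 aX bX ab)[].
move=> h0 h1 h2 [[|[|[|//]]] i].
- by rewrite -h0; congr k; apply: val_inj.
- by rewrite -h1; congr k; apply: val_inj.
- by rewrite -h2; congr k; apply: val_inj.
Qed.

Lemma motion_supported p s X t1 t2 th : supported X (motion p s X t1 t2 th).
Proof. exact: restr_supported. Qed.

(** The rows are orthogonal to a three-dimensional space of rigid motions inside the 2|X|
    coordinates. *)
Lemma balanced_size p s X L a b : a \in X -> b \in X ->
    (sg (s a) * p a 0, p a 1) != (sg (s b) * p b 0, p b 1) ->
    free L -> (forall l, l \in L -> supported X l) ->
    (forall l t1 t2 th, l \in L -> dotm l (motion p s X t1 t2 th) = 0) ->
  (size L + 3 <= 2 * #|X|)%N.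
Proof.
move=> aX bX ab fL sL oL.
apply: (free_orth_size fL (motions_free aX bX ab) sL).
  by move=> k; rewrite !inE => /or3P[] /eqP ->; apply: motion_supported.
by move=> l k lL; rewrite !inE => /or3P[] /eqP ->; apply: oL.
Qed.

(** Outside the span of the three motions, the restriction of [q] would be a fourth independent
    vector orthogonal to the rows, exceeding the dimension 2|X|. *)
Lemma balanced_rigid p s X L a b q : a \in X -> b \in X ->
    (sg (s a) * p a 0, p a 1) != (sg (s b) * p b 0, p b 1) ->
    free L -> (forall l, l \in L -> supported X l) ->
    (forall l t1 t2 th, l \in L -> dotm l (motion p s X t1 t2 th) = 0) ->
    (2 * #|X| <= size L + 3)%N -> (forall l, l \in L -> dotm l q = 0) ->
  exists t1 t2 th, restr X q = motion p s X t1 t2 th.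
Proof.
move=> aX bX ab fL sL oL hL oq.
pose K := [:: motion p s X 1 0 0; motion p s X 0 1 0; motion p s X 0 0 1].
have [|nq] := boolP (restr X q \in <<K>>%VS).
  rewrite span_cons => /memv_addP[_ /vlineP[t1 ->] [w + ->]].
  rewrite span_cons => /memv_addP[_ /vlineP[t2 ->] [w' + ->]].
  rewrite span_seq1 => /vlineP[th ->]; exists t1, t2, th.
  by rewrite motion_lin.
have fK : free (restr X q :: K) by rewrite free_cons nq /= (motions_free aX bX ab).
have : (size L + size (restr X q :: K) <= 2 * #|X|)%N; last by move=> /leq_trans /(_ hL); rewrite leq_add2l.
apply: (free_orth_size fL fK sL).
  move=> k; rewrite !inE => /or4P[] /eqP ->; try exact: motion_supported.
  exact: restr_supported.
move=> l k lL; rewrite !inE => /or4P[] /eqP ->; try exact: oL.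
by rewrite dotm_restr ?oq //; apply: sL.
Qed.

Lemma translation_neq0 p s X a : a \in X -> motion p s X 0 1 0 != 0.
Proof.
move=> aX; apply/eqP => /matrixP /(_ a 1); rewrite motionE1 // mxE mul0r addr0.
by move/eqP; rewrite oner_eq0.
Qed.

Lemma translation_size p s X L a : a \in X ->
    free L -> (forall l, l \in L -> supported X l) ->
    (forall l, l \in L -> dotm l (motion p s X 0 1 0) = 0) ->
  (size L + 1 <= 2 * #|X|)%N.
Proof.
move=> aX fL sL oL.
have fK : free [:: motion p s X 0 1 0] by rewrite seq1_free (translation_neq0 _ _ aX).
apply: (free_orth_size fL fK sL) => [k|l k lL]; rewrite inE => /eqP ->.
  exact: motion_supported.
exact: oL.
Qed.

Lemma translation_rigid p s X L a q : a \in X ->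
    free L -> (forall l, l \in L -> supported X l) ->
    (forall l, l \in L -> dotm l (motion p s X 0 1 0) = 0) ->
    (2 * #|X| <= size L + 1)%N -> (forall l, l \in L -> dotm l q = 0) ->
  exists t, restr X q = motion p s X 0 t 0.
Proof.
move=> aX fL sL oL hL oq.
have [|nq] := boolP (restr X q \in <<[:: motion p s X 0 1 0]>>%VS).
  rewrite span_seq1 => /vlineP[t ->]; exists t.
  by rewrite -[RHS]motion_lin !scale0r addr0 add0r.
have fK : free [:: restr X q; motion p s X 0 1 0].
  by rewrite free_cons nq /= seq1_free (translation_neq0 _ _ aX).
have := free_orth_size fL fK sL; rewrite /= => h.
suff: (size L + 2 <= 2 * #|X|)%N by move=> /leq_trans /(_ hL); rewrite leq_add2l.
apply: h => [k|l k lL]; rewrite !inE => /orP[] /eqP ->.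
- exact: restr_supported.
- exact: motion_supported.
- by rewrite dotm_restr ?oq //; apply: sL.
- exact: oL.
Qed.

End Rigidity.

(** * Genericity *)

Section CofinitePredicates.
Variable R : realFieldType.

(** A nonzero polynomial records the exceptional values of [t]; finite conjunctions then become
    products. *)
Definition cofinite (P : R -> Prop) :=
  exists2 f : {poly R}, f != 0 & forall t, f.[t] != 0 -> P t.

Lemma poly_nonroot (f : {poly R}) : f != 0 -> exists t, f.[t] != 0.
Proof.
(* The integers below [size f] are distinct in an ordered field and too many to be all roots of
   [f]. *)
move=> f0; pose rs : seq R := [seq i%:R | i <- iota 0 (size f)].
have urs : uniq rs by rewrite map_inj_uniq ?iota_uniq // => i j /eqP; rewrite eqr_nat => /eqP.
have [/(max_poly_roots f0) /(_ urs)|] := boolP (all (root f) rs).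
  by rewrite size_map size_iota ltnn.
by case/allPn => t _ ft; exists t.
Qed.

Lemma cofinite_ex P : cofinite P -> exists t, P t.
Proof. by case=> f /poly_nonroot[t ft] h; exists t; apply: h. Qed.

Lemma cofinite_and P Q : cofinite P -> cofinite Q -> cofinite (fun t => P t /\ Q t).
Proof.
case=> f f0 hf [g g0 hg]; exists (f * g); first by rewrite mulf_neq0.
by move=> t; rewrite hornerM mulf_eq0 negb_or => /andP[/hf ? /hg ?].
Qed.

Lemma cofinite_forall (I : finType) (P : I -> R -> Prop) :
  (forall i, cofinite (P i)) -> cofinite (fun t => forall i, P i t).
Proof.
move=> h; have [i|f hf] := @fin_all_exists I (fun _ => {poly R})
    (fun i f => f != 0 /\ forall t, f.[t] != 0 -> P i t).
  by have [f f0 hf] := h i; exists f.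
exists (\prod_i f i); first by apply/prodf_neq0 => i _; case: (hf i).
move=> t; rewrite horner_prod => /prodf_neq0 ft i.
by case: (hf i) => _; apply; apply: ft.
Qed.

Lemma cofinite_imply (b : bool) (P : R -> Prop) :
  (b -> cofinite P) -> cofinite (fun t => b -> P t).
Proof.
case: b => h; last by exists 1; rewrite ?oner_eq0.
by case: (h isT) => f f0 hf; exists f => // t /hf.
Qed.

End CofinitePredicates.

(** * Lifts in general position *)

Section Genericity.
Variables (R : realFieldType) (n : nat).
Implicit Types (p q : 'M[R]_(n, 2)) (a b c : 'I_n * bool) (E : seq (edge n)).

(** With [ly], the coordinates of the lift of a vertex to a given sheet; the reflection fixes the
    second one. *)
Definition lx p a : R := sg R a.2 * p a.1 0.
Definition ly p a : R := p a.1 1.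

(** Twice the signed area of the triangle formed by three lifts. *)
Definition tri p a b c :=
  (lx p b - lx p a) * (ly p c - ly p a) - (lx p c - lx p a) * (ly p b - ly p a).

(** For the two lifts of one vertex, the first condition says that the vertex is off the mirror. *)
Definition general_position p :=
  (forall ab : ('I_n * bool) * ('I_n * bool), ab.1 != ab.2 -> lx p ab.1 != lx p ab.2) /\
  (forall abc : ('I_n * bool) * ('I_n * bool) * ('I_n * bool),
    uniq [:: abc.1.1; abc.1.2; abc.2] -> tri p abc.1.1 abc.1.2 abc.2 != 0).

(* All lifts lie on the parabola y = x^2, with distinct abscissae. *)
Definition parabola_points : 'M[R]_(n, 2) :=
  \matrix_(u, k) if k == 0 then u.+1%:R else u.+1%:R ^+ 2.

Lemma lx_parabola a b : a != b -> lx parabola_points a != lx parabola_points b.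
Proof.
apply: contra; rewrite /lx !mxE /=; case: a b => [u i] [w j] /=.
have pu (z : 'I_n) : 0 < z.+1%:R :> R by rewrite ltr0Sn.
have := (pu u, pu w) => -[uu ww].
(* Abscissae on different sheets have opposite signs, so only equal sheets remain. *)
case: i j => -[] /eqP; rewrite /sg => h; try by exfalso; lra.
  have : u.+1%:R = w.+1%:R :> R by lra.
  by move/eqP; rewrite eqr_nat eqSS => /eqP /val_inj ->.
have : u.+1%:R = w.+1%:R :> R by lra.
by move/eqP; rewrite eqr_nat eqSS => /eqP /val_inj ->.
Qed.

Lemma parabola_general : general_position parabola_points.
Proof.
split=> [[a b]|[[a b] c]] /=; first exact: lx_parabola.
rewrite !inE negb_or andbT => /andP[/andP[ab ac] bc].
have lyE d : ly parabola_points d = lx parabola_points d ^+ 2.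
  by rewrite /ly /lx !mxE /= exprMn; case: d.2; rewrite /sg ?sqrrN expr1n mul1r.
rewrite /tri !lyE.
set x := lx _ a; set y := lx _ b; set z := lx _ c.
(* On the parabola the area is a Vandermonde determinant. *)
have -> : (y - x) * (z ^+ 2 - x ^+ 2) - (z - x) * (y ^+ 2 - x ^+ 2)
  = (y - x) * (z - x) * (z - y) by ring.
by rewrite !mulf_neq0 // subr_eq0 eq_sym lx_parabola.
Qed.

Definition line p q (t : R) := p + t *: (q - p).

Lemma lx_line p q t a : lx (line p q t) a = lx p a + t * (lx q a - lx p a).
Proof. by rewrite /lx !mxE; ring. Qed.

Lemma ly_line p q t a : ly (line p q t) a = ly p a + t * (ly q a - ly p a).
Proof. by rewrite /ly !mxE; ring. Qed.

(** Each condition is the nonvanishing of a polynomial in [t] that is nonzero at t = 1, where the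
    line passes through [q]. *)
Lemma general_position_line p q : general_position q ->
  cofinite (fun t => general_position (line p q t)).
Proof.
case=> gx gt; pose P (f : 'M[R]_(n, 2) -> 'I_n * bool -> R) a : {poly R} :=
  (f p a)%:P + 'X * (f q a - f p a)%:P.
apply: cofinite_and; apply: cofinite_forall.
  case=> a b /=; apply: cofinite_imply => /(gx (a, b)) /= ab.
  have pE t : (P lx a - P lx b).[t] = lx (line p q t) a - lx (line p q t) b.
    by rewrite !lx_line /P !hornerE.
  exists (P lx a - P lx b) => [|t]; last by rewrite pE subr_eq0.
  apply: contra_neq ab => /(congr1 (horner^~ 1)); rewrite pE horner0 !lx_line; lra.
case=> -[a b] c; apply: cofinite_imply => /(gt (a, b, c)) /= abc.
pose F := (P lx b - P lx a) * (P ly c - P ly a) - (P lx c - P lx a) * (P ly b - P ly a).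
have pE t : F.[t] = tri (line p q t) a b c.
  by rewrite /tri !lx_line !ly_line /F /P !hornerE.
exists F => [|t]; last by rewrite pE.
apply: contra_neq abc => /(congr1 (horner^~ 1)); rewrite pE horner0 => <-.
by rewrite /tri !lx_line !ly_line; ring.
Qed.

Lemma rig_row_line p q t e :
  rig_row (line p q t) e = rig_row p e + t *: (rig_row q e - rig_row p e).
Proof.
apply/matrixP => u k; rewrite /rig_row /dir_row /xdiff /ydiff !mxE; ring.
Qed.

(** The determinant of the products of the rows at [p] with the rows at the moving configuration is
    polynomial in [t]; at t = 0 it is the Gram determinant of a free family. *)
Lemma free_line p q E : free (map (rig_row p) E) ->
  cofinite (fun t => free (map (rig_row (line p q t)) E)).
Proof.
set L := map (rig_row p) E => fL; set k := size E.
have sL : size L = k by rewrite size_map.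
pose Ep (i : 'I_k) := tnth (in_tuple E) i.
have LE r (i : 'I_k) : (map (rig_row r) E)`_i = rig_row r (Ep i).
  by rewrite (nth_map (Ep i)) ?ltn_ord //; congr (rig_row r _); rewrite [RHS](tnth_nth (Ep i)).
pose M r : 'M[R]_k := \matrix_(i, j) dotm (rig_row p (Ep j)) (rig_row r (Ep i)).
have Mfree r : \det (M r) != 0 -> free (map (rig_row r) E).
  move=> dM.
  have sz : size (map (rig_row r) E) == k by rewrite size_map.
  apply/(freeP (X := Tuple sz)) => c /= c0.
  have : (\row_i c i) *m M r = 0.
    apply/rowP => j; rewrite !mxE.
    transitivity (dotm (rig_row p (Ep j)) (\sum_(i < k) c i *: (map (rig_row r) E)`_i)).
      rewrite linear_sum; apply: eq_bigr => i _; rewrite !mxE LE linearZ /=.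
      by rewrite /GRing.scale.
    by rewrite c0 linear0.
  move=> h i; suff /rowP /(_ i) : \row_i c i = 0 by rewrite !mxE.
  apply/eqP; apply: contraNT dM => c'0; apply/det0P; by exists (\row_i c i).
(* A kernel vector of the Gram matrix gives a combination [S] of the rows orthogonal to each row,
   hence to itself. *)
have Mp : \det (M p) != 0.
  apply/det0P => -[c c0 cM]; case/negP: c0; apply/eqP.
  have sz : size L == k by rewrite sL.
  move: (fL) => /(freeP (X := Tuple sz)) fL'; apply/rowP => i; rewrite mxE.
  apply: (fL' (c 0)) => /=; apply: dotm_eq0.
  set S := \sum_(i < k) _.
  have oS j : dotm (rig_row p (Ep j)) S = 0.
    have /rowP /(_ j) := cM; rewrite !mxE => <-; rewrite linear_sum.
    by apply: eq_bigr => l _; rewrite linearZ /= LE mxE.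
  rewrite {2}/S linear_sum big1 // => l _.
  by rewrite linearZ /= LE dotmC oS scaler0.
pose F : 'M[{poly R}]_k := \matrix_(i, j) ((M p i j)%:P + 'X * (M q i j - M p i j)%:P).
have FE t : (\det F).[t] = \det (M (line p q t)).
  rewrite -horner_evalE -det_map_mx; congr (\det _); apply/matrixP => i j.
  rewrite !mxE rig_row_line /= /horner_eval !hornerE.
  move: (rig_row p (Ep j)) (rig_row p (Ep i)) (rig_row q (Ep i)) => u v w.
  by rewrite linearD linearZ /= linearB.
exists (\det F) => [|t]; last by rewrite FE => /Mfree.
apply: contra_neq Mp => /(congr1 (horner^~ 0)); rewrite FE horner0 => <-.
by congr (\det _); apply/matrixP => i j; rewrite !mxE /line scale0r addr0.
Qed.

(** On the line from [p] to the parabola points, independence holds at one end and general position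
    at the other, so both hold at a common [t]. *)
Lemma free_general p E : free (map (rig_row p) E) ->
  exists2 q, free (map (rig_row q) E) & general_position q.
Proof.
move=> fp; have [t [? ?]] := cofinite_ex (cofinite_and
  (free_line parabola_points fp) (general_position_line p parabola_general)).
by exists (line p parabola_points t).
Qed.

End Genericity.

(** * Vertex extensions *)

Section Extensions.
Variables (R : realFieldType) (n : nat) (v : 'I_n).
Implicit Types (p q r : 'M[R]_(n, 2)) (L : seq 'M[R]_(n, 2)) (E : seq (edge n)).

Lemma free_cons_coord L r k : (forall l, l \in L -> l v k = 0) -> r v k != 0 ->
  free L -> free (r :: L).
Proof.
move=> h rk fL; rewrite free_cons fL andbT; apply: contra rk => /(span_coord h).
by move=> ->.
Qed.

(** All of [L] vanishes at [v], where the two new rows form an invertible 2 by 2 block. *)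
Lemma free_cons2_coord L (r1 r2 : 'M[R]_(n, 2)) :
    (forall l, l \in L -> l v 0 = 0) -> (forall l, l \in L -> l v 1 = 0) ->
    r1 v 0 * r2 v 1 - r1 v 1 * r2 v 0 != 0 ->
  free L -> free [:: r1, r2 & L].
Proof.
move=> h0 h1 hr fL; rewrite free_cons; apply/andP; split.
  apply: contra hr; rewrite span_cons => /memv_addP[_ /vlineP[c ->] [w wL ->]].
  by rewrite !mxE (span_coord h0 wL) (span_coord h1 wL); apply/eqP; ring.
have [r0|] := eqVneq (r2 v 0) 0; last by move/free_cons_coord; apply.
apply: (free_cons_coord h1) => //; apply: contra_neq hr => r1'.
by rewrite r0 r1'; ring.
Qed.

(** Edges avoiding [v] keep their rows, so the place of [v] can be chosen to suit the new edges. *)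
Definition move_point p (z : R * R) : 'M[R]_(n, 2) :=
  \matrix_(u, k) if u == v then (if k == 0 then z.1 else z.2) else p u k.

Lemma rig_row_move p z e : within (~: [set v]) e ->
  rig_row (move_point p z) e = rig_row p e.
Proof.
case/andP; rewrite !inE => /negbTE h1 /negbTE h2.
by rewrite /rig_row /xdiff /ydiff !mxE h1 h2.
Qed.

Lemma rig_rows_move p z E : all (within (~: [set v])) E ->
  map (rig_row (move_point p z)) E = map (rig_row p) E.
Proof. by move/allP => h; apply/eq_in_map => e /h /rig_row_move ->. Qed.

Lemma rig_rows_coord p E k : all (within (~: [set v])) E ->
  forall l, l \in map (rig_row p) E -> l v k = 0.
Proof.
move=> /allP h _ /mapP[e /h eE ->]; apply: (dir_row_supported _ _ eE).
by rewrite !inE eqxx.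
Qed.

Lemma rig_row_star0 p z a g : a != v ->
  rig_row (move_point p z) (v, a, g) v 0 = z.1 - lx p (a, g).
Proof.
move=> /negbTE av; rewrite /rig_row /dir_row /xdiff /ydiff /lx !mxE /= !eqxx av eq_sym av /=.
by ring.
Qed.

Lemma rig_row_star1 p z a g : a != v ->
  rig_row (move_point p z) (v, a, g) v 1 = z.2 - ly p (a, g).
Proof.
move=> /negbTE av; rewrite /rig_row /dir_row /xdiff /ydiff /ly !mxE /= !eqxx av eq_sym av /=.
by ring.
Qed.

(** The edge vector is (-2 z.1, 0), and both ends of the loop are [v], which doubles its
    contribution. *)
Lemma rig_row_loop0 p z :
  rig_row (move_point p z) (v, v, true) v 0 = 4 * z.1.
Proof.
rewrite /rig_row /dir_row /xdiff /ydiff !mxE /= !eqxx /sg /=.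
by ring.
Qed.

Lemma rig_row_loop1 p z :
  rig_row (move_point p z) (v, v, true) v 1 = 0.
Proof.
rewrite /rig_row /dir_row /xdiff /ydiff !mxE /= !eqxx /sg /=.
by ring.
Qed.

Variables (p : 'M[R]_(n, 2)) (E : seq (edge n)).
Hypothesis Ev : all (within (~: [set v])) E.

Lemma extend_edge a g : a != v -> free (map (rig_row p) E) ->
  exists q, free (map (rig_row q) ((v, a, g) :: E)).
Proof.
move=> av fE; exists (move_point p (lx p (a, g) + 1, 0)).
rewrite map_cons rig_rows_move //.
apply: (free_cons_coord (rig_rows_coord 0 Ev)) => //.
by rewrite rig_row_star0 //= addrAC subrr add0r oner_eq0.
Qed.

Lemma extend_loop : free (map (rig_row p) E) ->
  exists q, free (map (rig_row q) ((v, v, true) :: E)).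
Proof.
move=> fE; exists (move_point p (1, 0)).
rewrite map_cons rig_rows_move //.
apply: (free_cons_coord (rig_rows_coord 0 Ev)) => //.
by rewrite rig_row_loop0 /= mulr1 pnatr_eq0.
Qed.

Lemma extend_loop_edge a g : a != v -> free (map (rig_row p) E) ->
  exists q, free (map (rig_row q) [:: (v, v, true), (v, a, g) & E]).
Proof.
(* Off the mirror the loop row is horizontal and nonzero at [v]; the height differs from that of the
   lift of [a], so the edge row is independent of it there. *)
move=> av fE; exists (move_point p (1, ly p (a, g) + 1)).
rewrite 2!map_cons rig_rows_move //.
apply: (free_cons2_coord (rig_rows_coord 0 Ev) (rig_rows_coord 1 Ev)) => //.
rewrite rig_row_loop0 rig_row_loop1 rig_row_star0 // rig_row_star1 //=.
by rewrite mul0r subr0 addrAC subrr add0r !mulr1 pnatr_eq0.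
Qed.

Lemma extend_two_edges a b ga gb : a != v -> b != v ->
    lx p (a, ga) != lx p (b, gb) -> free (map (rig_row p) E) ->
  exists q, free (map (rig_row q) [:: (v, a, ga), (v, b, gb) & E]).
Proof.
move=> av bv ab fE.
pose x := lx p (a, ga); pose y := ly p (a, ga).
pose z := lx p (b, gb); pose t := ly p (b, gb).
(* The lift of [b] turned by a right angle about that of [a]: the determinant at [v] is then the
   squared distance between the two lifts. *)
exists (move_point p (x - (t - y), y + (z - x))).
rewrite 2!map_cons rig_rows_move //.
apply: (free_cons2_coord (rig_rows_coord 0 Ev) (rig_rows_coord 1 Ev)) => //.
rewrite !rig_row_star0 // !rig_row_star1 //= -/x -/y -/z -/t.
rewrite gt_eqF //.
have : 0 < (x - z) ^+ 2 by rewrite lt0r sqr_ge0 sqrf_eq0 subr_eq0 ab.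
have := sqr_ge0 (y - t); nra.
Qed.

(* The point v goes to the midpoint of the lifts of a and b, so that the edges va
   and vb carry a stress resolving the removed edge ab. *)
Lemma extend_three_edges a b c ga gb gc : a != v -> b != v -> c != v ->
    tri p (a, ga) (b, gb) (c, gc) != 0 ->
    free (map (rig_row p) ((a, b, ga (+) gb) :: E)) ->
  exists q, free (map (rig_row q) [:: (v, c, gc), (v, a, ga), (v, b, gb) & E]).
Proof.
move=> av bv cv abc fE.
pose x := lx p (a, ga); pose y := ly p (a, ga).
pose z := lx p (b, gb); pose t := ly p (b, gb).
pose q := move_point p ((x + z) / 2, (y + t) / 2); exists q.
rewrite 3!map_cons rig_rows_move //.
have q0 := rig_rows_coord (p := p) 0 Ev; have q1 := rig_rows_coord (p := p) 1 Ev.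
move: fE; rewrite map_cons free_cons => /andP[abE fE].
(* The midpoint makes the rows of va and vb opposite at [v], and their sum is half the row of ab. *)
have rab : rig_row p (a, b, ga (+) gb)
    = 2 *: (rig_row q (v, a, ga) + rig_row q (v, b, gb)).
  apply/matrixP => i j; rewrite /rig_row /dir_row /xdiff /ydiff /q !mxE /= !eqxx.
  rewrite (negbTE av) (negbTE bv) /x /y /z /t /lx /ly.
  by case: (ga); case: (gb); rewrite /sg /=; field.
have rb0 : rig_row q (v, b, gb) v 0 = - rig_row q (v, a, ga) v 0.
  by rewrite !rig_row_star0 //= -/x -/z; field.
have rb1 : rig_row q (v, b, gb) v 1 = - rig_row q (v, a, ga) v 1.
  by rewrite !rig_row_star1 //= -/y -/t; field.
have ra : (rig_row q (v, a, ga) v 0 != 0) || (rig_row q (v, a, ga) v 1 != 0).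
  rewrite -negb_and; apply: contra abc => /andP[].
  rewrite rig_row_star0 // rig_row_star1 //= -/x -/y => /eqP h0 /eqP h1.
  have zx : z = x by lra.
  have ty : t = y by lra.
  by rewrite /tri -/x -/y -/z -/t zx ty; apply/eqP; ring.
(* The midpoint lies on the line ab and c does not, so vc and va point in independent directions. *)
have hc : rig_row q (v, c, gc) v 0 * rig_row q (v, a, ga) v 1
    - rig_row q (v, c, gc) v 1 * rig_row q (v, a, ga) v 0 != 0.
  apply: contra_neq abc; rewrite !rig_row_star0 // !rig_row_star1 //= -/x -/y.
  rewrite /tri -/x -/y -/z -/t; nra.
move: rab rb0 rb1 ra hc; set rc := rig_row q (v, c, gc).
set sa := rig_row q (v, a, ga); set sb := rig_row q (v, b, gb) => rab rb0 rb1 ra hc.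
clearbody rc sa sb.
have frb : free (sb :: map (rig_row p) E).
  case/orP: ra => ra; [apply: (free_cons_coord q0) | apply: (free_cons_coord q1)] => //.
    by rewrite rb0 oppr_eq0.
  by rewrite rb1 oppr_eq0.
(* At [v] the span of the other rows is the line of [sa], which misses [rc]. *)
rewrite free_cons; apply/andP; split.
  apply: contra hc; rewrite 2!span_cons.
  move=> /memv_addP[_ /vlineP[k ->] [_ /memv_addP[_ /vlineP[l ->] [w wE ->]] ->]].
  by rewrite !mxE rb0 rb1 (span_coord q0 wE) (span_coord q1 wE); apply/eqP; ring.
(* Comparing at [v] forces the coefficient -1 on [sb], so [sa + sb], half of the removed row, would
   lie in the span of the rows of [E]. *)
rewrite free_cons frb andbT; apply: contra abE; rewrite span_cons.
move=> /memv_addP[_ /vlineP[k ->] [w wE sE]].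
have k1 : k = -1.
  have := (congr1 (fun m : 'M_(n, 2) => m v 0) sE, congr1 (fun m : 'M_(n, 2) => m v 1) sE).
  rewrite !mxE rb0 rb1 (span_coord q0 wE) (span_coord q1 wE) => -[s0 s1].
  case/orP: ra => /mulfI; apply; lra.
by rewrite rab sE k1 scaleN1r addrAC addNr add0r memvZ.
Qed.

End Extensions.

(** * Tight sets *)

Section SparseLemmas.
Variable n : nat.
Implicit Types (X Y : {set 'I_n}) (s : 'I_n -> bool) (E S : seq (edge n)).

Lemma sparse_count E S : (forall P : pred (edge n), (count P S <= count P E)%N) ->
  sparse E -> sparse S.
Proof.
move=> h [h1 h2]; split=> [X X0|s X X0].
  by apply: leq_trans (h1 X _); [rewrite leq_add2r; apply: h | apply: leq_trans X0 (h _)].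
by apply: leq_trans (h2 s X _); [rewrite leq_add2r; apply: h | apply: leq_trans X0 (h _)].
Qed.

Lemma sparse_perm E S : perm_eq E S -> sparse E -> sparse S.
Proof. by move=> /permP h; apply: sparse_count => P; rewrite h. Qed.

Lemma sparse_cat E S : sparse (S ++ E) -> sparse E.
Proof. by apply: sparse_count => P; rewrite count_cat leq_addl. Qed.

(** A loop of color 0 is balanced on a single vertex, which would require 1 + 3 <= 2. *)
Lemma sparse_loop v g E : sparse ((v, v, g) :: E) -> g.
Proof.
case: g => // -[_ /(_ (fun=> false) [set v])].
by rewrite /= /within /balanced /= !inE !eqxx cards1; lia.
Qed.

(** Two parallel edges of equal color form a balanced pair on two vertices, which would require 2 +
    3 <= 4. *)
Lemma sparse_star v a b ga gb E : a != v -> b != v ->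
  sparse [:: (v, a, ga), (v, b, gb) & E] -> (a, ga) != (b, gb).
Proof.
move=> av bv [_ h]; apply/eqP => -[ab gab].
have := h (fun u => if u == a then ga else false) [set v; a].
rewrite /= /within /balanced /= !inE -gab -ab !eqxx !orbT eq_sym (negbTE av) /= eqxx.
by rewrite cards2 eq_sym av; lia.
Qed.

Lemma within_avoid v X e : within (~: [set v]) e -> within (X :\ v) e = within X e.
Proof. by rewrite /within !inE => /andP[-> ->]. Qed.

Lemma sub_within X Y e : X \subset Y -> within X e -> within Y e.
Proof. by move=> /subsetP XY /andP[/XY h1 /XY h2]; apply/andP. Qed.

(** Lets the edges at [v] be recognized by their source; reversing an edge keeps its color in
    Z/2Z. *)
Definition normalize v (e : edge n) : edge n :=
  if e.1.2 == v then (v, e.1.1, e.2) else e.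

Lemma sparse_normalize v E : sparse E -> sparse (map (normalize v) E).
Proof.
have hw X : preim (normalize v) (within X) =1 within X.
  move=> [[i j] c]; rewrite /= /normalize /within /=.
  by case: eqP => //= ->; rewrite andbC.
have hb s : preim (normalize v) (balanced s) =1 balanced s.
  move=> [[i j] c]; rewrite /= /normalize /balanced /=.
  by case: (j =P v) => //= ->; rewrite addbC.
case=> h1 h2; split=> [X|s X]; rewrite count_map.
  by rewrite (eq_count (hw X)); apply: h1.
rewrite (@eq_count _ _ (predI (within X) (balanced s))); first exact: h2.
by move=> e; have /= -> := hw X e; have /= -> := hb s e.
Qed.

(** The degrees, with loops counted twice, sum to twice the number of edges, which is less than
    4|Y|. *)
Lemma low_degree Y E : (size E < 2 * #|Y|)%N ->
  exists2 v, v \in Y &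
    (count (fun e => e.1.1 == v) E + count (fun e => e.1.2 == v) E <= 3)%N.
Proof.
pose deg v := (count (fun e : edge n => e.1.1 == v) E + count (fun e => e.1.2 == v) E)%N.
move=> hE; apply/exists_inP; apply: contraLR hE => /exists_inPn h.
have cs (f : edge n -> 'I_n) : (\sum_v count (fun e => f e == v) E = size E)%N.
  elim: E {deg h} => [|e E IH] /=; first by rewrite big1.
  rewrite big_split /= IH (bigD1 (f e)) //= eqxx big1 ?addn0 // => u.
  by rewrite eq_sym => /negbTE ->.
have : (4 * #|Y| <= \sum_(v in Y) deg v)%N.
  rewrite mulnC -sum_nat_const; apply: leq_sum => v vY.
  by have := h v vY; rewrite -ltnNge.
have : (\sum_(v in Y) deg v <= \sum_v deg v)%N.
  by rewrite [leqRHS](bigID (mem Y)) /= leq_addr.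
suff -> : (\sum_v deg v = size E + size E)%N by lia.
by rewrite big_split; congr addn; [exact: (cs (fun e => e.1.1)) | exact: (cs (fun e => e.1.2))].
Qed.

End SparseLemmas.

(** * Rigid sets obtained from a forbidden edge *)

Section Blocks.
Variables (R : realFieldType) (n : nat) (v : 'I_n).
Variables (p : 'M[R]_(n, 2)) (E : seq (edge n)).
Hypothesis Ev : all (within (~: [set v])) E.
Hypothesis fE : free (map (rig_row p) E).
Hypothesis sE : sparse E.
Hypothesis gp : general_position p.
Implicit Types (a b c : 'I_n * bool) (X : {set 'I_n}) (s : 'I_n -> bool) (q : 'M[R]_(n, 2)).

Definition block_edges X s (t : bool) : pred (edge n) :=
  if t then within X else predI (within X) (balanced s).

(* A set of vertices on which E only allows rigid motions: with [t = false] the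
   balanced edges already force an arbitrary rigid motion of the lift selected by s,
   with [t = true] all the edges force a translation along the mirror. *)
Definition rigid_block X s t a b :=
  [/\ v \notin X, a.1 \in X, b.1 \in X, ~~ t -> s a.1 = a.2 /\ s b.1 = b.2 &
   forall q, (forall e, e \in E -> block_edges X s t e -> dotm (rig_row p e) q = 0) ->
     exists t1 t2 th, (t -> t1 = 0 /\ th = 0) /\ restr X q = motion p s X t1 t2 th].

(** A set violating the counts once ab is inserted must contain ab and be tight for [E]; its
    independent rows then leave only the rigid motions orthogonal to them. *)
Lemma block_exists a b : a != b -> a.1 != v -> b.1 != v ->
    ~ sparse ((a.1, b.1, a.2 (+) b.2) :: E) ->
  exists X s t, rigid_block X s t a b.
Proof.
move=> ab av bv; have [h1 h2] := sE.
(* Deleting [v] from a set loses no edge of [E], so the tight set may be taken to avoid [v]. *)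
have cv X (P : pred (edge n)) :
    count (predI (within (X :\ v)) P) E = count (predI (within X) P) E.
  by apply: eq_in_count => e /(allP Ev) /= /within_avoid ->.
have cv' X : count (within (X :\ v)) E = count (within X) E.
  by apply: eq_in_count => e /(allP Ev) /= /within_avoid ->.
have sub X : (#|X :\ v| <= #|X|)%N by apply/subset_leq_card/subD1set.
have size_rows (P : pred (edge n)) : size (map (rig_row p) (filter P E)) = count P E.
  by rewrite size_map size_filter.
have rows_supp X (P : pred (edge n)) : {subset P <= within X} ->
    forall l, l \in map (rig_row p) (filter P E) -> supported X l.
  move=> PX _ /mapP[e + ->]; rewrite mem_filter => /andP[/PX eX _].
  exact: dir_row_supported.
case/not_andP => /existsNP[].
- move=> X0 /not_implyP[/= c0 /negP]; rewrite -ltnNge => hX.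
  have eX : within X0 (a.1, b.1, a.2 (+) b.2).
    apply/negPn/negP => /negbTE eX; move: c0 hX; rewrite eX !add0n => /h1.
    by rewrite leqNgt => /negP.
  have /andP[/= aX bX] : within (X0 :\ v) (a.1, b.1, a.2 (+) b.2).
    by rewrite within_avoid // /within /= !inE av.
  exists (X0 :\ v), (fun=> false), true; split=> // [|q hq]; first by rewrite !inE eqxx.
  have [t qt] : exists t, restr (X0 :\ v) q = motion p (fun=> false) (X0 :\ v) 0 t 0.
    apply: (translation_rigid (L := map (rig_row p) (filter (within (X0 :\ v)) E)) aX).
    - exact: free_map_filter.
    - exact: rows_supp.
    - move=> _ /mapP[e + ->]; rewrite mem_filter => /andP[eX' _].
      exact: rig_row_translation.
    - move: hX; have := sub X0; rewrite size_rows cv' eX.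
      by move: #|X0| #|X0 :\ v| (count _ E) => x y z; clear; lia.
    - by move=> _ /mapP[e + ->]; rewrite mem_filter => /andP[? ?]; apply: hq.
  by exists 0, t, 0.
- move=> s0 /existsNP[X0 /not_implyP[/= c0 /negP]]; rewrite -ltnNge => hX.
  have /andP[eX /eqP /= es] : predI (within X0) (balanced s0) (a.1, b.1, a.2 (+) b.2).
    apply/negPn/negP => /negbTE eX; move: c0 hX; rewrite /= in eX; rewrite eX !add0n => /h2.
    by rewrite leqNgt => /negP.
  have /andP[/= aX bX] : within (X0 :\ v) (a.1, b.1, a.2 (+) b.2).
    by rewrite within_avoid // /within /= !inE av.
  (* A constant shift preserves balance and makes the potential agree with the sheet of [a]; balance
     of ab then gives the sheet of [b]. *)
  pose s u := s0 u (+) (s0 a.1 (+) a.2).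
  have sa : s a.1 = a.2 by rewrite /s addKb.
  have sb : s b.1 = b.2.
    by rewrite /s addbA [s0 b.1 (+) _]addbC -es -addbA [b.2 (+) _]addbC addKb.
  have bs : balanced s =1 balanced s0.
    by move=> e; rewrite /balanced /s addbACA addbb addbF.
  exists (X0 :\ v), s, false; split=> // [|q hq]; first by rewrite !inE eqxx.
  have [||||||t1 [t2 [th qt]]] := @balanced_rigid _ _ p s (X0 :\ v)
      (map (rig_row p) (filter (predI (within (X0 :\ v)) (balanced s)) E)) a.1 b.1 q aX bX.
  - rewrite sa sb; apply: contra_neq (gp.1 (a, b) ab); exact: (congr1 fst).
  - exact: free_map_filter.
  - by apply: rows_supp => e /andP[].
  - move=> _ t1 t2 th /mapP[e + ->]; rewrite mem_filter => /andP[/andP[? ?] _].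
    exact: rig_row_motion.
  - rewrite size_rows cv; move: hX; have := sub X0.
    rewrite eX /balanced /= -es eqxx.
    have -> : count (predI (within X0) (balanced s)) E = count (predI (within X0) (balanced s0)) E.
      by apply: eq_count => e /=; rewrite bs.
    by rewrite /balanced /=; move: #|X0| #|X0 :\ v| (count _ E) => x y z; clear; lia.
  - by move=> _ /mapP[e + ->]; rewrite mem_filter => /andP[? ?]; apply: hq.
  by exists t1, t2, th.
Qed.
End Blocks.

(** * Three rigid sets on the sides of a triangle *)

Section TriangleOfBlocks.
Variables (R : realFieldType) (n : nat) (v : 'I_n).
Variables (p : 'M[R]_(n, 2)) (E : seq (edge n)).
Hypothesis gp : general_position p.
Implicit Types (a b c : 'I_n * bool) (X : {set 'I_n}) (s : 'I_n -> bool) (q : 'M[R]_(n, 2)).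

(* Rigid motions m1, m2, m3 with m1 = m2 at b, m2 = m3 at c, m3 = m1 at a. *)
Lemma motions_agree a b c (t1 t2 th t1' t2' th' t1'' t2'' th'' : R) :
    tri p a b c != 0 ->
    t1 - th * ly p b = t1' - th' * ly p b -> t2 + th * lx p b = t2' + th' * lx p b ->
    t1' - th' * ly p c = t1'' - th'' * ly p c -> t2' + th' * lx p c = t2'' + th'' * lx p c ->
    t1'' - th'' * ly p a = t1 - th * ly p a -> t2'' + th'' * lx p a = t2 + th * lx p a ->
  [/\ t1' = t1, t2' = t2 & th' = th] /\ [/\ t1'' = t1, t2'' = t2 & th'' = th].
Proof.
rewrite /tri; move: (lx p a) (lx p b) (lx p c) (ly p a) (ly p b) (ly p c).
move=> xa xb xc ya yb yc D hb1 hb2 hc1 hc2 ha1 ha2.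
(* Summing around the triangle eliminates the translation parts; the differences of angular
   velocities solve a homogeneous 2 by 2 system of determinant [tri] up to sign. *)
have hy : (th - th') * (yb - ya) + (th' - th'') * (yc - ya) = 0 by lra.
have hx : (th - th') * (xb - xa) + (th' - th'') * (xc - xa) = 0 by lra.
have e1 : th - th' = 0.
  apply: (mulIf D); rewrite mul0r.
  transitivity ((yc - ya) * ((th - th') * (xb - xa) + (th' - th'') * (xc - xa))
    - (xc - xa) * ((th - th') * (yb - ya) + (th' - th'') * (yc - ya))); first by ring.
  by rewrite hx hy; ring.
have e2 : th' - th'' = 0.
  apply: (mulIf D); rewrite mul0r.
  transitivity ((xb - xa) * ((th - th') * (yb - ya) + (th' - th'') * (yc - ya))
    - (yb - ya) * ((th - th') * (xb - xa) + (th' - th'') * (xc - xa))); first by ring.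
  by rewrite hx hy; ring.
have {e2} e2 : th'' = th' by lra.
have {e1} e1 : th' = th by lra.
by rewrite e2 e1 in hb1 hb2 hc1 hc2 ha1 ha2 *; split; split=> //; lra.
Qed.

(** Velocities are read at the lifts [a] and [b] themselves. If [t] holds, the sheets of [s] may
    differ from theirs, but a translation along the mirror is the same on both. *)
Lemma block_motion X s t a b q t1 t2 th :
    rigid_block v p E X s t a b -> (t -> t1 = 0 /\ th = 0) ->
    restr X q = motion p s X t1 t2 th ->
  [/\ t1 - th * ly p a = sg R a.2 * q a.1 0, t2 + th * lx p a = q a.1 1,
      t1 - th * ly p b = sg R b.2 * q b.1 0 & t2 + th * lx p b = q b.1 1].
Proof.
case=> _ aX bX hs _ ht /matrixP h.
have := (h a.1 0, h a.1 1, h b.1 0, h b.1 1).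
rewrite !motionE0 // !motionE1 // !mxE aX bX => -[[[-> ->] ->] ->].
case: t hs ht => [_ /(_ isT)[-> ->]|/(_ isT)[-> ->] _].
  by rewrite !mul0r !subr0 !mulr0.
by rewrite /lx /ly !mulrA; case: a.2; case: b.2; rewrite /sg; split=> //; ring.
Qed.

(** One rigid motion moves [u] and its mirror image symmetrically; since [u] is off the mirror, it
    is a translation along the mirror. *)
Lemma inconsistent_motion X1 X2 s1 s2 q t1 t2 th u :
    u \in X1 -> u \in X2 -> s1 u != s2 u ->
    restr X1 q = motion p s1 X1 t1 t2 th -> restr X2 q = motion p s2 X2 t1 t2 th ->
  t1 = 0 /\ th = 0.
Proof.
move=> u1 u2 su /matrixP h1 /matrixP h2.
have := (h1 u 0, h1 u 1, h2 u 0, h2 u 1).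
rewrite !motionE0 // !motionE1 // !mxE u1 u2 => -[[[-> ->]]].
have x0 : p u 0 != 0.
  have := gp.1 ((u, false), (u, true)).
  rewrite /= xpair_eqE eqxx => /(_ isT); rewrite /lx /sg /= mul1r mulN1r.
  by apply: contra_neq => ->; rewrite oppr0.
have th0 (x : R) : th * x = 0 -> x = p u 0 -> th = 0.
  by move=> h xE; apply: (mulIf x0); rewrite mul0r -xE.
move: su; case: (s1 u); case: (s2 u) => // _; rewrite /sg => e1 e2.
  have t0 : th = 0 by apply: (th0 (p u 0)); lra.
  by rewrite t0 in e1 *; split=> //; lra.
have t0 : th = 0 by apply: (th0 (p u 0)); lra.
by rewrite t0 in e1 *; split=> //; lra.
Qed.

Lemma motion_zero X s q u k : u \in X -> restr X q = motion p s X 0 0 0 -> q u k = 0.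
Proof.
move=> uX /matrixP /(_ u k); rewrite !mxE uX => ->.
by case: ifP => _; ring.
Qed.

(** The block edges in [E] allow a single rigid motion on the union [Y], so they number at least
    2|Y| - 1, or 2|Y| - 3 if balanced; with the three edges at [v], the set [v |: Y] exceeds its
    count. *)
Lemma triangle_of_blocks a b c X1 s1 t1 X2 s2 t2 X3 s3 t3 :
    sparse [:: (v, a.1, a.2), (v, b.1, b.2), (v, c.1, c.2) & E] ->
    uniq [:: a; b; c] ->
    rigid_block v p E X1 s1 t1 a b -> rigid_block v p E X2 s2 t2 b c ->
    rigid_block v p E X3 s3 t3 c a ->
  False.
Proof.
move=> [sp1 sp2] abc B1 B2 B3.
have D := gp.2 (a, b, c) abc; rewrite /= in D.
have ab : lx p a != lx p b.
  by apply: (gp.1 (a, b)); move: abc; rewrite /= !inE negb_or => /andP[/andP[]].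
have [v1 a1 b1 h1 r1] := B1; have [v2 b2 c2 h2 r2] := B2; have [v3 c3 a3 h3 r3] := B3.
pose Y := X1 :|: X2 :|: X3.
pose f : pred (edge n) := predU (predU (block_edges X1 s1 t1) (block_edges X2 s2 t2))
  (block_edges X3 s3 t3).
have vY : v \notin Y by rewrite !inE negb_or negb_or v1 v2 v3.
have cY : #|v |: Y| = (#|Y| + 1)%N by rewrite cardsU1 vY addnC.
have wX X s t e : block_edges X s t e -> within X e.
  by case: t => //= /andP[].
have fY e : f e -> within (v |: Y) e.
  case/orP => [/orP[]|] /wX; apply: sub_within; apply/subsetP => u uX;
    by rewrite !inE uX ?orbT.
have starY : within (v |: Y) (v, a.1, a.2) && within (v |: Y) (v, b.1, b.2)
    && within (v |: Y) (v, c.1, c.2).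
  by rewrite /within /= !inE eqxx a1 b1 c2 !orbT.
(* Either some block already allows translations only, or two blocks choose different sheets at a
   common vertex; only translations along the mirror then survive. *)
pose unb := [\/ [\/ t1, t2 | t3],
  exists u, [/\ u \in X1, u \in X2 & s1 u != s2 u],
  exists u, [/\ u \in X2, u \in X3 & s2 u != s3 u] |
  exists u, [/\ u \in X3, u \in X1 & s3 u != s1 u]].
have key q : (forall e, e \in filter f E -> dotm (rig_row p e) q = 0) ->
  exists T1 T2 th, [/\ unb -> T1 = 0 /\ th = 0, restr X1 q = motion p s1 X1 T1 T2 th,
    restr X2 q = motion p s2 X2 T1 T2 th & restr X3 q = motion p s3 X3 T1 T2 th].
  move=> hq.
  have hf e : e \in E -> f e -> dotm (rig_row p e) q = 0.
    by move=> eE fe; apply: hq; rewrite mem_filter fe.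
  have [|T1 [T2 [th [u1 m1]]]] := r1 q.
    by move=> e eE fe; apply: hf => //; rewrite /f /= fe.
  have [|T1' [T2' [th' [u2 m2]]]] := r2 q.
    by move=> e eE fe; apply: hf => //; rewrite /f /= fe orbT.
  have [|T1'' [T2'' [th'' [u3 m3]]]] := r3 q.
    by move=> e eE fe; apply: hf => //; rewrite /f /= fe orbT.
  have [A1 A2 A3 A4] := block_motion B1 u1 m1.
  have [A5 A6 A7 A8] := block_motion B2 u2 m2.
  have [A9 A10 A11 A12] := block_motion B3 u3 m3.
  have [||||||[E1 E2 E3] [E4 E5 E6]] :=
    @motions_agree a b c T1 T2 th T1' T2' th' T1'' T2'' th'' D.
  - by rewrite A3 A5.
  - by rewrite A4 A6.
  - by rewrite A7 A9.
  - by rewrite A8 A10.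
  - by rewrite A11 A1.
  - by rewrite A12 A2.
  subst T1' T2' th' T1'' T2'' th''; exists T1, T2, th; split=> //.
  case=> [[/u1|/u2|/u3]//|[u [ua ub su]]|[u [ua ub su]]|[u [ua ub su]]].
  - exact: inconsistent_motion ua ub su m1 m2.
  - exact: inconsistent_motion ua ub su m2 m3.
  - exact: inconsistent_motion ua ub su m3 m1.
have zero q : supported Y q -> restr X1 q = motion p s1 X1 0 0 0 ->
    restr X2 q = motion p s2 X2 0 0 0 -> restr X3 q = motion p s3 X3 0 0 0 -> q = 0.
  move=> sq m1 m2 m3; apply/matrixP => u k; rewrite mxE.
  have [|/sq -> //] := boolP (u \in Y); rewrite !inE => /orP[/orP[]|] uX.
  - exact: motion_zero uX m1.
  - exact: motion_zero uX m2.
  - exact: motion_zero uX m3.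
(* In the unbalanced case there are at most 2|Y| - 2 block edges: one pinned coordinate still leaves
   a nonzero motion, a translation that the pin kills. *)
have [U|U] := pselect unb.
  have := sp1 (v |: Y); rewrite /=; move: starY => /andP[/andP[-> ->] ->].
  have := sub_count fY E; rewrite cY => le /(_ isT) lt.
  have [|q [q0 sq oq]] :=
      @exists_orth_supported _ _ Y (delta_mx a.1 1 :: map (rig_row p) (filter f E)).
    by rewrite /= size_map size_filter; move: lt le; move: (count _ E) (count f E) #|Y| => x y z; clear; lia.
  have [e /(map_f (rig_row p)) eF|T1 [T2 [th [/(_ U)[T10 th0] m1 m2 m3]]]] := key q.
    by apply: oq; rewrite inE eF orbT.
  subst T1 th.
  have q1 : q a.1 1 = 0 by rewrite -dotm_delta dotmC oq ?mem_head.
  have T20 : T2 = 0.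
    by have [_ + _ _] := block_motion B1 (fun=> conj erefl erefl) m1; rewrite q1 mul0r addr0.
  by subst T2; case/eqP: q0; apply: zero.
have [nt1 nt2 nt3] : [/\ ~~ t1, ~~ t2 & ~~ t3].
  by split; apply/negP => t; apply: U; do 2 constructor.
(* In the remaining case the sheets agree on overlaps and glue to one potential on [Y]. *)
pose s u := if u \in X1 then s1 u else if u \in X2 then s2 u else
  if u \in X3 then s3 u else false.
have agree (Xi Xj : {set 'I_n}) (si sj : 'I_n -> bool) u :
    ~ (exists u, [/\ u \in Xi, u \in Xj & si u != sj u]) ->
    u \in Xi -> u \in Xj -> si u = sj u :> bool.
  by move=> h ui uj; apply/eqP/negPn/negP => su; apply: h; exists u.
have a12 : ~ (exists u, [/\ u \in X1, u \in X2 & s1 u != s2 u]) by move=> h; apply: U; apply: Or42.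
have a23 : ~ (exists u, [/\ u \in X2, u \in X3 & s2 u != s3 u]) by move=> h; apply: U; apply: Or43.
have a31 : ~ (exists u, [/\ u \in X3, u \in X1 & s3 u != s1 u]) by move=> h; apply: U; apply: Or44.
have S1 u : u \in X1 -> s u = s1 u by rewrite /s => ->.
have S2 u : u \in X2 -> s u = s2 u.
  by move=> u2; rewrite /s u2; case: ifP => // u1; exact: (agree X1 X2 s1 s2 u a12 u1 u2).
have S3 u : u \in X3 -> s u = s3 u.
  move=> u3; rewrite /s u3; case: ifP => [u1|_].
    by rewrite (agree X3 X1 s3 s1 u a31 u3 u1).
  by case: ifP => // u2; exact: (agree X2 X3 s2 s3 u a23 u2 u3).
(* The default sheet at [v] makes the edges to [a], [b] and [c] balanced. *)
have sv : s v = false by rewrite /s (negbTE v1) (negbTE v2) (negbTE v3).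
have bal X (si : 'I_n -> bool) (ti : bool) e : ~~ ti -> (forall u, u \in X -> s u = si u) ->
    block_edges X si ti e -> balanced s e.
  case: ti => // _ hs /andP[/andP[i j]]; by rewrite /balanced !hs.
have fB e : f e -> predI (within (v |: Y)) (balanced s) e.
  move=> fe; rewrite /= fY //=; case/orP: fe => [/orP[]|].
  - exact: bal nt1 S1.
  - exact: bal nt2 S2.
  - exact: bal nt3 S3.
have := sp2 s (v |: Y); rewrite /=; move: starY => /andP[/andP[-> ->] ->].
rewrite /balanced /= sv (S1 a.1) // (S1 b.1) // (S2 c.1) // (h1 nt1).1 (h1 nt1).2 (h2 nt2).2 !eqxx /=.
have := sub_count fB E; rewrite cY /balanced => le /(_ isT) lt.
(* There are at most 2|Y| - 4 block edges. Pinning both coordinates of [a] and the height of [b]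
   kills every rigid motion, as these lifts have distinct abscissae. *)
have [|q [q0 sq oq]] := @exists_orth_supported _ _ Y
    [:: delta_mx a.1 0, delta_mx a.1 1, delta_mx b.1 1 & map (rig_row p) (filter f E)].
  rewrite /= size_map size_filter; move: lt le => /=.
  by move: (count _ E) (count f E) #|Y| => x y z; clear; lia.
have [e /(map_f (rig_row p)) eF|T1 [T2 [th [_ m1 m2 m3]]]] := key q.
  by apply: oq; rewrite !inE eF !orbT.
have nt : t1 -> T1 = 0 /\ th = 0 by move/negP: nt1.
have [] := block_motion B1 nt m1.
have -> : q a.1 0 = 0 by rewrite -dotm_delta dotmC oq // !inE eqxx.
have -> : q a.1 1 = 0 by rewrite -dotm_delta dotmC oq // !inE eqxx orbT.
have -> : q b.1 1 = 0 by rewrite -dotm_delta dotmC oq // !inE eqxx !orbT.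
move=> e1 e2 _ e3.
have /eqP : th * (lx p a - lx p b) = 0 by lra.
rewrite mulf_eq0 subr_eq0 (negbTE ab) orbF => /eqP th0; subst th.
have T10 : T1 = 0 by lra.
have T20 : T2 = 0 by lra.
by subst T1 T2; case/eqP: q0; apply: zero.
Qed.
End TriangleOfBlocks.

(** * Sparse families of edges are generically independent *)

Lemma leq_add_count (T : Type) (P1 P2 Q1 Q2 : pred T) (s : seq T) :
    (forall x, (P1 x + P2 x <= Q1 x + Q2 x)%N) ->
  (count P1 s + count P2 s <= count Q1 s + count Q2 s)%N.
Proof.
move=> h; elim: s => //= x s; move/(leq_add (h x)).
by rewrite addnACA [(Q1 x + _ + _)%N]addnACA.
Qed.

Section SparseIndependent.
Variables (R : realFieldType) (n : nat).
Implicit Types (p : 'M[R]_(n, 2)) (E S : seq (edge n)) (Y : {set 'I_n}).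

Definition independent E := exists p, free (map (rig_row p) E).

Lemma independent_perm E S : perm_eq E S -> independent E -> independent S.
Proof.
by move=> ES [p fp]; exists p; move/(perm_map (rig_row p))/perm_free: ES => <-.
Qed.

(** Reversal applies the reflection of the edge color and a sign to both the edge vector and its
    coefficients, and these cancel. *)
Lemma rig_row_normalize p v e : rig_row p (normalize v e) = rig_row p e.
Proof.
case: e => -[i j] c; rewrite /normalize /=; case: (j =P v) => //= <-.
apply/matrixP => u k; rewrite /rig_row /dir_row /xdiff /ydiff !mxE /=.
by case: c; rewrite /sg; ring.
Qed.

Lemma extend_three v (Z : {set 'I_n}) E (a b c : 'I_n * bool) : v \notin Z ->
    all (within Z) E -> a.1 \in Z -> b.1 \in Z -> c.1 \in Z ->
    (forall S, all (within Z) S -> sparse S -> independent S) ->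
    sparse [:: (v, a.1, a.2), (v, b.1, b.2), (v, c.1, c.2) & E] ->
  independent [:: (v, a.1, a.2), (v, b.1, b.2), (v, c.1, c.2) & E].
Proof.
move=> vZ EZ aZ bZ cZ IH sp.
have Zv (u : 'I_n) : u \in Z -> u != v by apply: contraTneq => ->.
have [av bv cv] := And3 (Zv _ aZ) (Zv _ bZ) (Zv _ cZ).
have Ev : all (within (~: [set v])) E.
  apply/allP => e /(allP EZ); apply: sub_within.
  by apply/subsetP => u /Zv; rewrite !inE.
have perm3 (x y z : edge n) : perm_eq [:: x, y, z & E] [:: y, z, x & E].
  by apply/permP => P /=; clear; lia.
(* Neighbours may coincide in the graph through parallel edges, but then the colors differ and the
   lifts are distinct. *)
have abc : uniq [:: a; b; c].
  have ab : a != b.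
    move: a b av bv sp {perm3 aZ bZ} => [a ga] [b gb] /= av bv sp.
    apply: (sparse_star (E := E) av bv); apply: sparse_count sp => P /=; clear; lia.
  have ac : a != c.
    move: a c av cv sp {perm3 ab aZ cZ} => [a ga] [c gc] /= av cv sp.
    apply: (sparse_star (E := E) av cv); apply: sparse_count sp => P /=; clear; lia.
  have bc : b != c.
    move: b c bv cv sp {perm3 ab ac bZ cZ} => [b gb] [c gc] /= bv cv sp.
    apply: (sparse_star (E := E) bv cv); apply: sparse_count sp => P /=; clear; lia.
  by rewrite /= !inE negb_or ab ac bc.
have step (x y z : 'I_n * bool) : x.1 \in Z -> y.1 \in Z -> z.1 \in Z ->
    uniq [:: x; y; z] -> sparse ((x.1, y.1, x.2 (+) y.2) :: E) ->
    independent [:: (v, z.1, z.2), (v, x.1, x.2), (v, y.1, y.2) & E].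
  move=> xZ yZ zZ xyz sxy.
  have [|p fp] := IH _ _ sxy; first by rewrite /= EZ /within /= xZ yZ.
  have [q fq gq] := free_general fp.
  apply: (extend_three_edges Ev (Zv _ xZ) (Zv _ yZ) (Zv _ zZ) _ fq).
  by have := gq.2 (x, y, z) xyz; case: x y z {xZ yZ zZ xyz sxy fp fq} => ? ? [? ?] [? ?].
have rot : uniq [:: b; c; a] by rewrite -(rot_uniq 1) in abc.
have rot' : uniq [:: c; a; b] by rewrite -(rot_uniq 1) in rot.
have [sab|nab] := pselect (sparse ((a.1, b.1, a.2 (+) b.2) :: E)).
  by apply: independent_perm (perm3 _ _ _) _; apply: step.
have [sbc|nbc] := pselect (sparse ((b.1, c.1, b.2 (+) c.2) :: E)).
  exact: step.
have [sca|nca] := pselect (sparse ((c.1, a.1, c.2 (+) a.2) :: E)).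
  by apply: independent_perm (perm3 _ _ _) _; apply: independent_perm (perm3 _ _ _) _; apply: step.
have sE : sparse E by apply: sparse_count sp => P /=; clear; lia.
have [p0 fp0] := IH E EZ sE; have [p fp gp] := free_general fp0.
move: abc; rewrite /= !inE negb_or andbT => /andP[/andP[ab ac] bc].
have [X1 [s1 [t1 B1]]] := block_exists Ev fp sE gp ab av bv nab.
have [X2 [s2 [t2 B2]]] := block_exists Ev fp sE gp bc bv cv nbc.
rewrite eq_sym in ac.
have [X3 [s3 [t3 B3]]] := block_exists Ev fp sE gp ac cv av nca.
by case: (triangle_of_blocks gp sp _ B1 B2 B3); rewrite -(rot_uniq 2) in rot.
Qed.

(** Induction on the size of a vertex set carrying all the edges, so that removing [v] shrinks this
    set while the matrices keep [n] rows. *)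
Lemma sparse_independent E : sparse E -> independent E.
Proof.
suff H k Y S : (#|Y| <= k)%N -> all (within Y) S -> sparse S -> independent S.
  apply: (H n [set: 'I_n]); first by rewrite cardsT card_ord.
  by apply/allP => e _; rewrite /within !inE.
elim: k Y S => [|k IH] Y [|e0 S0]; try by exists 0; rewrite /= nil_free.
  by rewrite leqn0 cards_eq0 => /eqP -> /=; rewrite /within !inE.
set S := e0 :: S0 => cY SY sp.
(* Sparsity at [Y] itself bounds the average degree below 4. *)
have szS : (size S < 2 * #|Y|)%N.
  by have := sp.1 Y; rewrite (eqP (etrans (esym (all_count _ _)) SY)) addn1; apply.
have [v vY dv] := low_degree szS.
suff : independent (map (normalize v) S).
  case=> p; rewrite -map_comp => fp; exists p.
  by rewrite (eq_map (g := rig_row p \o normalize v)) // => e; rewrite /= rig_row_normalize.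
have sp1 := sparse_normalize v sp.
set T := map (normalize v) S in sp1 *.
have TY : all (within Y) T.
  rewrite all_map; apply/allP => -[[i j] c] /(allP SY) /andP[/= iY jY].
  by rewrite /normalize /within /=; case: (j =P v) => /= [<-|_]; rewrite iY jY.
pose at_v (e : edge n) := e.1.1 == v.
(* A loop appears in both counts: three edges at [v] exclude loops, and two edges allow at most
   one. *)
have dT : (count at_v T + count (fun e => at_v e && (e.1.2 == v)) T <= 3)%N.
  apply: leq_trans dv; rewrite /T !count_map; apply: leq_add_count => -[[i j] c].
  rewrite /normalize /at_v /=; case: (j =P v) => [jv|/eqP/negbTE jv] /=.
    by rewrite eqxx; case: (i == v).
  by rewrite jv andbF.
pose U := filter (predC at_v) T.
have perm : perm_eq (filter at_v T ++ U) T by apply/permPl/perm_filterC.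
have Uv : all (within (~: [set v])) U.
  apply/allP => e; rewrite mem_filter => /andP[ev /mapP[[[i j] c] _ eE]].
  move: ev; rewrite eE /normalize /within /at_v /=.
  case: (j =P v) => /= [_|/eqP jv]; first by rewrite eqxx.
  by rewrite !inE => ->.
have vZ : v \notin Y :\ v by rewrite !inE eqxx.
have UZ : all (within (Y :\ v)) U.
  apply/allP => e eU; rewrite within_avoid; last exact: (allP Uv).
  by apply: (allP TY); move: eU; rewrite mem_filter => /andP[].
have IHv W : all (within (Y :\ v)) W -> sparse W -> independent W.
  by apply: IH; move: cY; rewrite (cardsD1 v Y) vY.
suff: independent (filter at_v T ++ U) by apply: independent_perm.
have starY : {subset filter at_v T <= within Y}.
  by move=> e; rewrite mem_filter => /andP[_ /(allP TY)].
have {dT} : (size (filter at_v T) + count (fun e => e.1.2 == v) (filter at_v T) <= 3)%N.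
  rewrite size_filter count_filter; apply: leq_trans dT; rewrite leq_add2l.
  by apply: eq_leq; apply: eq_count => e /=; rewrite andbC.
have {sp1} : sparse (filter at_v T ++ U) by apply: sparse_perm sp1; rewrite perm_sym.
have : all at_v (filter at_v T) by apply: filter_all.
move: (filter at_v T) starY => st stY st_v sps szst.
have sU := sparse_cat sps; have [p fp] := IHv U UZ sU; have [q fq gq] := free_general fp.
have inZ a g : (v, a, g) \in st -> a != v -> a \in Y :\ v.
  by move=> /stY /andP[/= _ aY] av; rewrite !inE av.
case: st st_v sps szst stY inZ => [|[[v1 a] ga] st] /=; first by exists p.
case/andP=> /eqP /= ->; case: st => [|[[v2 b] gb] st] /=.
  move=> _ sps _ _ inZ; have [av|av] := eqVneq a v.
    by rewrite av in sps *; move: (sparse_loop sps) => ->; apply: extend_loop fp.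
  exact: extend_edge av fp.
case/andP=> /eqP /= ->; case: st => [|[[v3 c] gc] st] /=.
  move=> _ sps + _ inZ; have [av|av] := eqVneq a v; have [bv|bv] := eqVneq b v => //= _.
  - rewrite av in sps *; move: (sparse_loop sps) => ->; exact: extend_loop_edge bv fp.
  - rewrite bv in sps *.
    have swap (x y : edge n) : perm_eq [:: x, y & U] [:: y, x & U].
      by apply/permP => P /=; clear; lia.
    move: (sparse_loop (sparse_perm (swap _ _) sps)) => ->.
    by apply: independent_perm (swap _ _) _; apply: extend_loop_edge av fp.
  - apply: (extend_two_edges Uv av bv _ fq); apply: (gq.1 ((a, ga), (b, gb))).
    exact: sparse_star sps.
case/andP=> /eqP /= ->; case: st => [|e st] /=; last first.
  by move=> _ _; rewrite !addSn.
move=> _ sps + _ inZ; have [_|av] := eqVneq a v => //; have [_|bv] := eqVneq b v => //.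
have [_|cv] := eqVneq c v => // _.
apply: (@extend_three v (Y :\ v) U (a, ga) (b, gb) (c, gc)) => //=.
- by apply: (inZ _ ga) av; rewrite !inE eqxx.
- by apply: (inZ _ gb) bv; rewrite !inE eqxx orbT.
- by apply: (inZ _ gc) cv; rewrite !inE eqxx !orbT.
Qed.

End SparseIndependent.

(** * Laman counts and sparsity *)

Section Walks.
Variables (n m : nat) (G : cgraph n m).
Implicit Types (F : {set 'I_m}) (X C : {set 'I_n}) (s : 'I_n -> bool).
Implicit Types (u v r : 'I_n) (w : seq ('I_m * bool)).

Definition edge_of (e : 'I_m) : edge n := (src G e, tgt G e, Defs.col G e).

Lemma walk_end_cat u w1 w2 :
  walk_end G u (w1 ++ w2) = obind (fun v => walk_end G v w2) (walk_end G u w1).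
Proof. by elim: w1 u => //= s1 w1 IH u; case: walk_step => //=. Qed.

Lemma walk_rho_cat w1 w2 : walk_rho G (w1 ++ w2) = walk_rho G w1 (+) walk_rho G w2.
Proof. by elim: w1 => //= s1 w1 IH; rewrite /walk_rho /= -!/(walk_rho _ _) IH addbA. Qed.

Lemma walk_step_sym u v e b :
  walk_step G u (e, b) = Some v -> walk_step G v (e, ~~ b) = Some u.
Proof.
by rewrite /walk_step; case: b => /=; case: eqP => // <- [<-]; rewrite eqxx.
Qed.

Lemma walk_rev F u v w : all (fun x => x.1 \in F) w -> walk_end G u w = Some v ->
  exists w', [/\ all (fun x => x.1 \in F) w', walk_end G v w' = Some u &
                 walk_rho G w' = walk_rho G w].
Proof.
elim: w u => [|[e b] w IH] u /=; first by move=> _ [->]; exists [::].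
case/andP=> eF wF; case E: walk_step => [x|//] /(IH _ wF)[w' [w'F ew' rw']].
exists (w' ++ [:: (e, ~~ b)]); split.
- by rewrite all_cat w'F /= eF.
- by rewrite walk_end_cat ew' /= (walk_step_sym E).
- by rewrite walk_rho_cat rw' /walk_rho /= addbF addbC.
Qed.

Lemma connect_walk F u v : connect (sub_adj G F) u v ->
  exists2 w, all (fun x => x.1 \in F) w & walk_end G u w = Some v.
Proof.
case/connectP => t; elim: t u => [|x t IH] u /=; first by move=> _ ->; exists [::].
case/andP=> /exists_inP[e eF h] /IH/[apply] -[w wF ew].
case/orP: h => /andP[/eqP h1 /eqP h2].
  by exists ((e, true) :: w); rewrite /= ?eF // /walk_step /= h1 eqxx h2.
by exists ((e, false) :: w); rewrite /= ?eF // /walk_step /= h2 eqxx h1.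
Qed.

(** Edge colors are differences of the potential and telescope along a walk. *)
Lemma balanced_walk F s u v w : (forall e, e \in F -> balanced s (edge_of e)) ->
  all (fun x => x.1 \in F) w -> walk_end G u w = Some v -> walk_rho G w = s u (+) s v.
Proof.
move=> bF; elim: w u => [|[e b] w IH] u /=.
  by move=> _ [->]; rewrite addbb.
case/andP=> /bF /eqP /= eb wF; case E: walk_step => [x|//] /(IH _ wF).
rewrite /walk_rho /= -/(walk_rho G w) eb => ->; move: E; rewrite /walk_step.
case: b => /=; case: eqP => // <- [<-]; first by rewrite addbA addbK.
by rewrite [s (src G e) (+) _]addbC addbA addbK.
Qed.

Lemma sub_adj_sym F : symmetric (sub_adj G F).
Proof. by move=> u v; apply: eq_existsb => e; rewrite orbC. Qed.

Definition component F v : {set 'I_n} := [set u | connect (sub_adj G F) v u].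

Lemma edge_connect F e : e \in F -> connect (sub_adj G F) (src G e) (tgt G e).
Proof.
move=> eF; apply: connect1; apply/exists_inP; exists e => //.
by rewrite !eqxx.
Qed.

Lemma component_src_tgt F e : e \in F -> component F (src G e) = component F (tgt G e).
Proof.
move=> /edge_connect h; apply/setP => u; rewrite !inE.
exact: same_connect (sym_connect_sym (@sub_adj_sym F)) _ _ h u.
Qed.

(** The potential of [u] is the parity of any walk from [r] to [u]; two such walks differ by a
    closed walk, whose image is trivial. *)
Lemma trivial_potential F r : ~ rho_nontrivial G F (component F r) ->
  exists s, forall e, e \in F -> component F (src G e) = component F r ->
    balanced s (edge_of e).
Proof.
move=> triv.
pose P b u w := [/\ all (fun x => x.1 \in F) w, walk_end G r w = Some u & walk_rho G w = b].
pose s u := `[< exists w, P true u w >].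
have rr : r \in component F r by rewrite inE.
have sE u w b : P b u w -> s u = b.
  case: b => Pw; first by apply/asboolP; exists w.
  apply/negbTE/asboolPn => -[w' [w'F ew' rw']]; apply: triv.
  case: Pw => wF /(walk_rev wF)[w1 [w1F ew1 rw1]] rw.
  exists r, (w' ++ w1); split=> //; first by rewrite all_cat w'F.
    by rewrite walk_end_cat ew'.
  by rewrite walk_rho_cat rw' rw1 rw.
exists s => e eF ce.
have /connect_walk[w wF ew] : connect (sub_adj G F) r (src G e).
  by have /setP /(_ (src G e)) := ce; rewrite !inE connect0 => <-.
rewrite /balanced /= (sE _ w _ (And3 wF ew erefl)).
have Pt : P (walk_rho G w (+) Defs.col G e) (tgt G e) (w ++ [:: (e, true)]).
  split; first by rewrite all_cat wF /= eF.
    by rewrite walk_end_cat ew /= /walk_step /= eqxx.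
  by rewrite walk_rho_cat /walk_rho /= addbF.
by rewrite (sE _ _ _ Pt) addKb.
Qed.

Lemma sub_vertices_src F e : e \in F -> src G e \in sub_vertices G F.
Proof. by move=> eF; rewrite inE; apply/exists_inP; exists e; rewrite ?eqxx. Qed.

Lemma sub_vertices_tgt F e : e \in F -> tgt G e \in sub_vertices G F.
Proof. by move=> eF; rewrite inE; apply/exists_inP; exists e; rewrite ?eqxx ?orbT. Qed.

Lemma card_components F : (c_nontriv G F + c_triv G F)%N = #|components G F|.
Proof.
rewrite /c_nontriv /c_triv -(cardsID [set C | `[< rho_nontrivial G F C >]] (components G F)).
by congr addn; apply: eq_card => C; rewrite !inE // andbC.
Qed.

Lemma count_edges (P : pred (edge n)) :
  count P (map edge_of (enum 'I_m)) = #|[set e | P (edge_of e)]|.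
Proof.
rewrite count_map -size_filter cardE; congr size.
rewrite enumT; apply: eq_filter => e; by rewrite /= inE.
Qed.

(** A nonempty edge set has at least one component, which yields the first bound; in a balanced set
    every component has trivial image, which yields the second. *)
Lemma laman_sparse : reflection_Laman G -> sparse (map edge_of (enum 'I_m)).
Proof.
case=> _ L.
have bound X F : (0 < #|F|)%N -> (forall e, e \in F -> within X (edge_of e)) ->
    (#|F| + (c_nontriv G F + c_triv G F) + 2 * c_triv G F <= 2 * #|X|)%N /\
    (0 < c_nontriv G F + c_triv G F)%N.
  move=> F0 FX; have sVX : sub_vertices G F \subset X.
    apply/subsetP => v; rewrite inE => /exists_inP[e /FX /andP[/= i j]].
    by case/orP => /eqP <-.
  have := subset_leq_card sVX; have := L F; split; first by lia.
  case/card_gt0P: F0 => e eF; rewrite card_components; apply/card_gt0P.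
  by exists (component F (src G e)); apply: imset_f; apply: sub_vertices_src.
split=> [X|s X]; rewrite count_edges => F0.
  have [|b1 b2] := bound X _ F0; first by move=> e; rewrite inE.
  by apply: leq_trans b1; rewrite -addnA leq_add2l; apply: leq_trans b2 (leq_addr _ _).
set F := [set e | _] in F0 *.
have [|b1 b2] := bound X _ F0; first by move=> e; rewrite inE => /andP[].
suff c0 : c_nontriv G F = 0%N by rewrite c0 add0n in b1 b2; move: b1 b2;
  move: #|F| #|X| (c_triv G F) => x y z; clear; lia.
apply/eqP; rewrite cards_eq0; apply/eqP/setP => C; rewrite !inE.
apply/negbTE/nandP; right; apply/asboolPn => -[v [w [_ wF ew rw]]].
have bF e : e \in F -> balanced s (edge_of e) by rewrite inE => /andP[].
by have := balanced_walk bF wF ew; rewrite rw addbb.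
Qed.

(** The counts for single vertex sets are applied to each connected component of [F] and added
    up. *)
Lemma sparse_laman : (m + 1 = 2 * n)%N ->
    (forall (F : {set 'I_m}) X, (0 < #|F|)%N ->
      (forall e, e \in F -> within X (edge_of e)) -> (#|F| + 1 <= 2 * #|X|)%N) ->
    (forall (F : {set 'I_m}) X s, (0 < #|F|)%N ->
      (forall e, e \in F -> within X (edge_of e)) ->
      (forall e, e \in F -> balanced s (edge_of e)) -> (#|F| + 3 <= 2 * #|X|)%N) ->
  reflection_Laman G.
Proof.
move=> hm h1 h2; split=> [|F]; first by lia.
pose nt (C : {set 'I_n}) : bool := `[< rho_nontrivial G F C >].
suff : (#|F| + c_nontriv G F + 3 * c_triv G F <= 2 * #|sub_vertices G F|)%N by lia.
have cE : (c_nontriv G F + 3 * c_triv G F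
    = \sum_(C in components G F) (if nt C then 1 else 3))%N.
  rewrite (bigID nt) /=; congr addn.
    rewrite /c_nontriv -sum1_card; apply: eq_big => C; rewrite !inE //.
    by case/andP=> _; rewrite /nt => ->.
  rewrite /c_triv mulnC -sum_nat_const; apply: eq_big => C; rewrite !inE //.
  by case/andP=> _; rewrite /nt => /negbTE ->.
have compV v : v \in sub_vertices G F -> component F v \in components G F.
  by move=> vF; apply: imset_f.
have eE : (#|F| = \sum_(C in components G F) #|[set e in F | component F (src G e) == C]|)%N.
  rewrite -sum1_card (partition_big (component F \o src G) (mem (components G F))) /=.
    by apply: eq_bigr => C _; rewrite -sum1_card; apply: eq_bigl => e; rewrite inE.
  by move=> e eF; apply/compV/sub_vertices_src.
have vE : (#|sub_vertices G F|
    = \sum_(C in components G F) #|[set v in sub_vertices G F | component F v == C]|)%N.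
  rewrite -sum1_card (partition_big (component F) (mem (components G F))) //=.
  by apply: eq_bigr => C _; rewrite -sum1_card; apply: eq_bigl => e; rewrite inE.
rewrite -addnA cE eE vE -big_split /= big_distrr /=; apply: leq_sum => C.
case/imsetP => r rF CE; rewrite -/(component F r) in CE.
set FC := [set e in F | _]; set XC := [set v in _ | _].
have FX e : e \in FC -> within XC (edge_of e).
  rewrite inE => /andP[eF /eqP ce]; apply/andP; split; rewrite inE /=.
    by rewrite sub_vertices_src //= ce.
  by rewrite sub_vertices_tgt //= -component_src_tgt // ce.
have FC0 : (0 < #|FC|)%N.
  move: rF; rewrite inE => /exists_inP[e eF] er; apply/card_gt0P.
  case/orP: er => /eqP er; exists e; rewrite inE eF CE /=; apply/eqP.
    by rewrite er.
  by rewrite component_src_tgt // er.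
rewrite /nt; case: asboolP => [_|]; first exact: h1.
rewrite CE => /trivial_potential[s hs]; apply: (h2 _ _ s) => // e.
by rewrite inE CE => /andP[eF /eqP]; apply: hs.
Qed.

End Walks.

(** * Special pairs *)

Lemma ord2_neq0 (k : 'I_2) : k != 0 -> k = 1.
Proof. by case: k => -[|[|]] // i _; apply: val_inj. Qed.

Section SpecialPairs.
Variables (R : realType) (n m : nat) (G : cgraph n m).
Hypothesis hm : (m + 1 = 2 * n)%N.
Implicit Types (d : 'I_m -> R * R) (q : 'M[R]_(n, 2)).

Definition mx_of_points (p : 'I_n -> R * R) : 'M[R]_(n, 2) :=
  \matrix_(u, k) if k == 0 then (p u).1 else (p u).2.

Definition points_of_mx q (u : 'I_n) : R * R := (q u 0, q u 1).

Lemma Phi_psub p e : psub (Phi (Defs.col G e) (p (tgt G e))) (p (src G e))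
  = (xdiff (mx_of_points p) (edge_of G e), ydiff (mx_of_points p) (edge_of G e)).
Proof.
rewrite /psub /Phi /xdiff /ydiff /edge_of !mxE /=.
by case: (Defs.col G e); rewrite /sg /= ?mulN1r ?mul1r.
Qed.

Lemma points_of_mxK q : mx_of_points (points_of_mx q) = q.
Proof.
apply/matrixP => u k; rewrite !mxE.
by have [->|/ord2_neq0 ->] := eqVneq k 0.
Qed.

(** Two quarter turns give -1, so realizations of the perpendicular network are the motions
    orthogonal to the direction rows. *)
Lemma dot_perp_perp d p e :
  dot (psub (Phi (Defs.col G e) (p (tgt G e))) (p (src G e))) (perp (perp (d e)))
  = - dotm (dir_row (edge_of G e) (d e).1 (d e).2) (mx_of_points p).
Proof. by rewrite Phi_psub dotm_dir_row /dot /perp /=; ring. Qed.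

Lemma faithful_diff (p : 'I_n -> R * R) e : faithful G p ->
  psub (Phi (Defs.col G e) (p (tgt G e))) (p (src G e)) != (0, 0).
Proof.
move=> /(_ e false); rewrite /lift_pos /= => h; apply/eqP => -[h1 h2]; apply: h.
by rewrite [LHS]surjective_pairing [RHS]surjective_pairing; congr (_, _); lra.
Qed.

Lemma parallel_dir (x d : R * R) : x != (0, 0) -> dot x (perp d) = 0 ->
  exists l, d = (l * x.1, l * x.2).
Proof.
case: x d => x1 x2 [d1 d2]; rewrite /dot /perp /= => x0 h.
have [x10|x10] := eqVneq x1 0.
  have x20 : x2 != 0 by apply: contra_neq x0 => ->; rewrite x10.
  exists (d2 / x2); rewrite x10 in h *; congr (_, _); last by rewrite divfK.
  by apply: (mulIf x20); lra.
exists (d1 / x1); congr (_, _); first by rewrite divfK.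
by apply: (mulIf x10); rewrite mulrAC divfK //; lra.
Qed.

Definition dir_rows d := map (fun e => dir_row (edge_of G e) (d e).1 (d e).2) (enum 'I_m).

Lemma size_dir_rows d : size (dir_rows d) = m.
Proof. by rewrite size_map size_enum_ord. Qed.

(** Dependent rows would leave a solution space of dimension at least 2, while collapsed solutions
    form only the line of translations along the mirror. *)
Lemma collapsed_free d :
    (forall p, is_realization G (fun e => perp (d e)) p -> collapsed p) ->
  free (dir_rows d).
Proof.
move=> hc; have n0 : (0 < n)%N by lia.
pose i0 := Ordinal n0.
rewrite /free eqn_leq dim_span /= leqNgt; apply/negP => ltL.
(* A basis of the span has at most 2n - 2 elements, leaving room to pin the height of [i0]. *)
pose B : seq 'M[R]_(n, 2) := delta_mx i0 1 :: vbasis <<dir_rows d>>.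
have [|q q0 oq] := @exists_orth _ _ B.
  by rewrite /= size_tuple; move: ltL; rewrite size_dir_rows; lia.
have qi1 : q i0 1 = 0 by rewrite -dotm_delta dotmC oq ?mem_head.
have real : is_realization G (fun e => perp (d e)) (points_of_mx q).
  move=> e; rewrite dot_perp_perp points_of_mxK; apply/eqP; rewrite oppr_eq0; apply/eqP.
  apply: (@span_orth _ _ (vbasis <<dir_rows d>>)) => [l lB|].
    by apply: oq; rewrite inE lB orbT.
  rewrite (span_basis (vbasisP _)); apply: memv_span.
  by apply: map_f; rewrite mem_enum.
have col := hc _ real.
case/eqP: q0; apply/matrixP => u k; rewrite mxE.
(* The two lifts of [u] coincide, so [u] is on the mirror; its height is that of [i0], namely 0. *)
have := col (u, false) (u, true); have := col (u, false) (i0, false).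
rewrite /lift_pos /points_of_mx /= qi1 => -[_ u1] [u0].
have [->|k0] := eqVneq k 0; first by lra.
by rewrite (ord2_neq0 k0).
Qed.

(** Every direction row is a multiple of a rigidity row at the faithful realization, hence
    orthogonal to the rigid motions, whose dimensions give the counts. *)
Lemma special_pair_laman d : special_pair G d -> reflection_Laman G.
Proof.
case=> -[p [rp fp]] /collapsed_free fL; set P := mx_of_points p.
have dir e : exists l, dir_row (edge_of G e) (d e).1 (d e).2 = l *: rig_row P (edge_of G e).
  have [l dE] := parallel_dir (faithful_diff e fp) (rp e); exists l.
  by rewrite dE Phi_psub /= /rig_row /dir_row [RHS]scalerDr !scalerA.
pose LF (F : {set 'I_m}) :=
  map (fun e => dir_row (edge_of G e) (d e).1 (d e).2) (filter (mem F) (enum 'I_m)).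
have fLF F : free (LF F) by apply: free_map_filter.
have sLF F : size (LF F) = #|F|.
  by rewrite size_map cardE; congr size; rewrite enumT.
have LFX (F : {set 'I_m}) X : (forall e, e \in F -> within X (edge_of G e)) ->
    forall l, l \in LF F -> supported X l.
  move=> FX _ /mapP[e + ->]; rewrite mem_filter => /andP[/= eF _].
  exact: dir_row_supported (FX e eF).
apply: sparse_laman => // [F X /card_gt0P[e0 e0F] FX|F X s /card_gt0P[e0 e0F] FX Fs].
  rewrite -sLF; have /andP[/= e0X _] := FX _ e0F.
  apply: (translation_size (p := P) (s := fun=> false) e0X (fLF F) (LFX F X FX)).
  move=> _ /mapP[e + ->]; rewrite mem_filter => /andP[/= eF _].
  have [l ->] := dir e; rewrite dotmC linearZ /= dotmC.
  by rewrite rig_row_translation ?scaler0 //; apply: FX.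
rewrite -sLF; have /andP[/= aX bX] := FX _ e0F.
apply: (balanced_size (p := P) (s := s) aX bX _ (fLF F) (LFX F X FX)).
  (* Faithfulness separates the lifted ends of [e0], which makes the three motions independent. *)
  have := faithful_diff e0 fp; rewrite Phi_psub; apply: contra_neq.
  have /eqP /= cE := Fs _ e0F; rewrite /xdiff /ydiff /= cE => -[e1 e2].
  congr (_, _); last by rewrite /P in e2; lra.
  by move: e1; rewrite -/P; case: (s _); case: (s _); rewrite /sg /=; lra.
move=> _ t1 t2 th /mapP[e + ->]; rewrite mem_filter => /andP[/= eF _].
have [l ->] := dir e; rewrite dotmC linearZ /= dotmC.
by rewrite rig_row_motion ?scaler0 //; [apply: FX | apply: Fs].
Qed.

Lemma laman_special_pair : reflection_Laman G -> exists d : 'I_m -> R * R, special_pair G d.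
Proof.
move=> /laman_sparse /(@sparse_independent R)[P fP].
pose d e := (xdiff P (edge_of G e), ydiff P (edge_of G e)).
exists d; rewrite -map_comp in fP.
split.
  exists (points_of_mx P); split=> [e|e g].
    by rewrite Phi_psub points_of_mxK /dot /perp /=; ring.
  move=> h.
  have [h1 h2] : xdiff P (edge_of G e) = 0 /\ ydiff P (edge_of G e) = 0.
    move: h; rewrite /lift_pos /points_of_mx /xdiff /ydiff /=.
    by case: g; case: (Defs.col G e) => -[]; rewrite /sg /= => ? ?; split; lra.
  have eL : rig_row P (edge_of G e) \in map (rig_row P \o edge_of G) (enum 'I_m).
    by apply: (map_f (rig_row P \o edge_of G)); rewrite mem_enum.
  by have := free_not0 fP eL; rewrite /rig_row h1 h2 /dir_row !scale0r addr0 eqxx.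
move=> p rp; have n0 : (0 < n)%N by lia.
have allT e : within [set: 'I_n] (edge_of G e) by rewrite /within !inE.
(* The 2n - 1 independent rows leave only translations along the mirror, which put every lift at one
   point (0, t). *)
have [|_ /mapP[e _ ->]||_ /mapP[e _ ->]|t /matrixP qt] :=
    @translation_rigid _ _ P (fun=> false) [set: 'I_n] _ (Ordinal n0)
      (mx_of_points p) (in_setT (Ordinal n0)) fP.
- by move=> _ /mapP[e _ ->]; apply: dir_row_supported.
- exact: rig_row_translation.
- by rewrite size_map size_enum_ord cardsT card_ord hm.
- by have /eqP := rp e; rewrite dot_perp_perp oppr_eq0 => /eqP.
have pE u : p u = (0, t).
  have := (qt u 0, qt u 1); rewrite !motionE0 // !motionE1 // !mxE !inE /= => -[h0 h1].
  by rewrite [LHS]surjective_pairing h0 h1; congr (_, _); ring.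
by move=> [u g] [w h]; rewrite /lift_pos /= !pE; case: g; case: h; rewrite /Phi /= ?oppr0.
Qed.

End SpecialPairs.

Theorem theorem2 (R : realType) (n m : nat) (G : cgraph n m)
  (hm : (m + 1 = 2 * n)%N) :
  (exists d : 'I_m -> R * R, special_pair G d) <-> reflection_Laman G.
Proof.
split=> [[d]|]; first exact: special_pair_laman.
exact: laman_special_pair.
Qed.
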